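(* Let $\Gamma$ be a finite group that is nilpotent of class $\le n$ (for an integer $n\ge 1$), and let $r\ge \max\{4^{n+1},20\}$ be an integer. Then the following assertions are equivalent: (i) For some Cayley graph $G$ of $\Gamma$, the $r$-local covering $G_r$ of $G$ has at least two ends that are separated by at most two vertices (i.e. there are two distinct ends of $G_r$ and a set $Y$ of at most two vertices of $G_r$ such that the two ends lie in distinct components of $G_r-Y$). (ii) Some Cayley graph of $\Gamma$ has an $r$-local separator of size at most $2$ (that is, an $r$-local cutvertex or an $r$-local $2$-separator), and $\Gamma$ has order $>r$. (iii) $\Gamma$ is isomorphic to $C_i\times C_j$ for some $i>r$ and $j\in\{1,2\}$, where $C_m$ denotes the cyclic group of order $m$.
   Context: Conventions: A generating set $S$ of a group $\Gamma$ does not contain the neutral element $\mathbb{I}$ and is closed under inverses. The Cayley graph $\mathrm{Cay}(\Gamma,S)$ is the simple graph with vertex set $\Gamma$ and edge set $\{\{g,gs\}: g\in\Gamma, s\in S\}$. Two group elements $a,b$ are equivalent, $a\equiv b$, if $a=b$ or $a=b^{-1}$. Iterated commutators: in the free group on $g,h$ define the words $[g,h]_1:=gh^{-1}g^{-1}h$ and, for $n\ge 2$, $[g,h]_n$ the reduced form of $g\,[g,h]_{n-1}^{-1}\,g^{-1}\,[g,h]_{n-1}$. A group $\Gamma$ is nilpotent of class $\le n$ if $[g,h]_n$ evaluates to $\mathbb{I}$ in $\Gamma$ for all $g,h\in\Gamma$ with $g\not\equiv h$. Balls: for a vertex $v$ of a graph $G$ and $r\in\mathbb{N}$, the ball $B_r(v)$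 is the subgraph of $G$ consisting of all vertices and edges lying on closed walks in $G$ of length at most $r$ passing through $v$. A vertex $v$ is an $r$-local cutvertex if $B_r(v)-v$ is disconnected. Local 2-separators: for distinct vertices $v_0,v_1$, let $N(\{v_0,v_1\})$ be the set of vertices outside $\{v_0,v_1\}$ adjacent to $v_0$ or $v_1$. The connectivity graph $C_r(v_0,v_1)$ has vertex set $N(\{v_0,v_1\})$, two vertices $a,b$ being adjacent if for some $i\in\{0,1\}$ they lie in the same component of $B_r(v_i)-v_0-v_1$. The set $\{v_0,v_1\}$ is an $r$-local $2$-separator if $C_r(v_0,v_1)$ is disconnected and the distance between $v_0$ and $v_1$ in $G$ is at most $r/2$. Local covering: for a connected graph $G$ (viewed as a 1-complex) and a base vertex $v_0$, the $r$-local covering $p_r\colon G_r\to G$ is the covering graph of $G$ corresponding to the (normal) subgroup of the fundamental group $\pi_1(G,v_0)$ generated by the classes of closed walks of the form $WCW^{-1}$, where $C$ is a closed walk of length at most $r$ and $W$ is a walk from $v_0$ to a vertex of $C$. Ends of a graph are the usual equivalence classes of rays. *)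

(* Defs.v *)
From mathcomp Require Import all_boot all_fingroup all_solvable.
From Stdlib Require Import Relations.
Set Implicit Arguments. Unset Strict Implicit. Unset Printing Implicit Defensive.

Inductive conn (T : Type) (V : T -> Prop) (E : T -> T -> Prop) : T -> T -> Prop :=
| conn_refl x : V x -> conn V E x x
| conn_step x y z : conn V E x y -> E y z -> V z -> conn V E x z.

Section Graphs.
Variables (T : finType) (e : rel T).

Definition cwalk_through (r : nat) (v : T) (s : seq T) : Prop :=
  exists x t, s = x :: t /\ path e x t /\ last x t = x /\ size t <= r /\ v \in s.

Definition ball_vertex (r : nat) (v x : T) : Prop :=
  exists s, cwalk_through r v s /\ x \in s.
Definition ball_edge (r : nat) (v a b : T) : Prop :=
  exists s, cwalk_through r v s /\
    ((a, b) \in zip s (behead s) \/ (b, a) \in zip s (behead s)).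

Definition ballX_vertex (r : nat) (v : T) (X : seq T) (x : T) : Prop :=
  ball_vertex r v x /\ x \notin X.
Definition ballX_edge (r : nat) (v : T) (X : seq T) (a b : T) : Prop :=
  ball_edge r v a b /\ a \notin X /\ b \notin X.

Definition local_cutvertex (r : nat) (v : T) : Prop :=
  exists x y, ballX_vertex r v [:: v] x /\ ballX_vertex r v [:: v] y /\
    ~ conn (ballX_vertex r v [:: v]) (ballX_edge r v [:: v]) x y.

Definition nbhd2 (v0 v1 x : T) : Prop :=
  x != v0 /\ x != v1 /\ (e v0 x || e v1 x).

Definition Cr_adj (r : nat) (v0 v1 a b : T) : Prop :=
  exists2 vi, vi \in [:: v0; v1] &
    conn (ballX_vertex r vi [:: v0; v1]) (ballX_edge r vi [:: v0; v1]) a b.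

Definition local_2sep (r : nat) (v0 v1 : T) : Prop :=
  v0 != v1 /\
  (exists a b, nbhd2 v0 v1 a /\ nbhd2 v0 v1 b /\
     ~ conn (nbhd2 v0 v1) (Cr_adj r v0 v1) a b) /\
  (exists p, path e v0 p /\ last v0 p = v1 /\ (size p).*2 <= r).

Definition has_local_sep_le2 (r : nat) : Prop :=
  (exists v, local_cutvertex r v) \/ (exists v0 v1, local_2sep r v0 v1).

End Graphs.

Local Open Scope group_scope.

Definition generating_set (gT : finGroupType) (S : {set gT}) : Prop :=
  1 \notin S /\ (forall x, x \in S -> x^-1 \in S) /\ <<S>> = [set: gT].

Definition cayley (gT : finGroupType) (S : {set gT}) : rel gT :=
  fun x y => x^-1 * y \in S.

Fixpoint comm_iter (gT : finGroupType) (k : nat) (g h : gT) : gT :=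
  match k with
  | 0 | 1 => g * h^-1 * g^-1 * h
  | k'.+1 => let c := comm_iter k' g h in g * c^-1 * g^-1 * c
  end.

Definition nil_class_le (gT : finGroupType) (n : nat) : Prop :=
  forall g h : gT, g != h -> g != h^-1 -> comm_iter n g h = 1.

(* ---------- the r-local covering G_r (base vertex 1) ----------
   Vertices: walks 1 :: w in G, up to the equivalence generated by
   removing/inserting backtracks and closed subwalks of length <= r. *)
Section Cover.
Variables (T : finType) (e : rel T) (v0 : T) (r : nat).

Definition valid_walk (s : seq T) : Prop :=
  exists w, s = v0 :: w /\ path e v0 w.

Inductive cover_move : seq T -> seq T -> Prop :=
| mv_backtrack p a b q : e a b ->
    cover_move (p ++ a :: q) (p ++ a :: b :: a :: q)
| mv_closed p a c q : path e a c -> last a c = a -> size c <= r ->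
    cover_move (p ++ a :: q) (p ++ a :: (c ++ q)).

Definition cover_equiv : seq T -> seq T -> Prop :=
  clos_refl_sym_trans (seq T) cover_move.

Definition cover_adj1 (s t : seq T) : Prop :=
  exists x, e (last v0 s) x /\ cover_equiv t (rcons s x).
Definition cover_edge (s t : seq T) : Prop := cover_adj1 s t \/ cover_adj1 t s.

Definition cover_avoid (Z : seq (seq T)) (s : seq T) : Prop :=
  valid_walk s /\ forall z, z \in Z -> ~ cover_equiv s z.

Definition cover_ray (f : nat -> seq T) : Prop :=
  (forall i, valid_walk (f i)) /\ (forall i, cover_edge (f i) (f i.+1)) /\
  (forall i j, cover_equiv (f i) (f j) -> i = j).

Definition same_end (f g : nat -> seq T) : Prop :=
  forall Z : seq (seq T), exists M,
    (forall i, M <= i -> cover_avoid Z (f i) /\ cover_avoid Z (g i)) /\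
    conn (cover_avoid Z) cover_edge (f M) (g M).

Definition two_ends_sep_le2 : Prop :=
  exists f g, cover_ray f /\ cover_ray g /\ ~ same_end f g /\
  exists Y : seq (seq T), size Y <= 2 /\ (forall y, y \in Y -> valid_walk y) /\
  exists M, (forall i, M <= i -> cover_avoid Y (f i) /\ cover_avoid Y (g i)) /\
    ~ conn (cover_avoid Y) cover_edge (f M) (g M).
End Cover.

(* Main.v *)
(** The [r]-local cover of [Cay(Gamma, S)] is the Cayley graph of the group [H] presented by the
    generators [S] and all words of length at most [r] that are trivial in [Gamma].  A local
    separator of [Cay(Gamma, S)] lifts to a genuine separator of the cover, because the parity of
    the number of times a walk changes between two given local components vanishes on short closed
    walks.

    Among all separators [{y0, y1}] of the cover take one with [y0], [y1] at minimal distance, and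
    let [A] be a component left by it.  The translates of [A] are then nested, as a geodesic between
    the two points of one separator would meet a crossing separator in a point giving a closer
    pair.  If [|S| >= 3], nestedness yields [g] in [S] or in [S S] with [g A] properly contained in
    [A].  The commutator relations, which [H] satisfies for short elements, force every generator to
    preserve the two ends of [<g>], and then to fix each of them.  Hence the translates of [A] form
    a chain, some generator [s] moves [A] properly into itself, and every coset [x <s>] meets
    [{y0, y1}], so that [<s>] has index at most two in [H].  Since [s] has infinite order in [H], its
    image in [Gamma] has order larger than [r]. *)
From HB Require Import structures.
Require Import Defs.
From Stdlib Require Import Relations.
From mathcomp Require Import all_boot all_fingroup all_solvable.
From mathcomp Require Import generic_quotient order ssralg ssrnum ssrint zify boolp.
Set Implicit Arguments. Unset Strict Implicit. Unset Printing Implicit Defensive.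
Local Open Scope group_scope.

(** * Cuts and their translates *)

(** The bound [4 ^ n.+1] is consumed by two estimates. The word [[g, h]_n], with one entry of length
    at most two and the other a letter, has length at most [5 * 2 ^ n - 4], so it is itself a
    relator of the cover. For at most two generators the only non-cyclic candidate is a dihedral
    group, whose order the commutator identity bounds by [2 ^ n.+1]. The obstacle is that [H] is not
    known to inherit nilpotency: only these few commutators are known to vanish in it. This is why
    [g] is sought among products of at most two generators, and why both [[g, h]_n] and [[h, g]_n]
    are evaluated. The former descends: if a commutator with [g] preserves the pair of ends of [g],
    then so does its other entry. The latter excludes swaps: for an [h] that swaps the ends, every
    [[h, g]_k] still moves [A] properly into itself. Three generators guarantee that no side of a
    separator is a single vertex, which is what makes a crossing of two minimal separators
    contradictory. *)

Section Cuts.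
Variables (H : groupType) (S : H -> Prop).
Hypothesis SV : forall s, S s -> S s^-1.
Hypothesis S_ind : forall Q : H -> Prop, Q 1 ->
  (forall x s, Q x -> S s -> Q (x * s)) -> forall x, Q x.

Lemma closed_full (Q : H -> Prop) x : Q x ->
  (forall y s, Q y -> S s -> Q (y * s)) -> forall y, Q y.
Proof.
move=> Qx Qs y; have h : forall z, Q (x * z).
  apply: S_ind; first by rewrite mulg1.
  by move=> z s Qz Ss; rewrite mulgA; apply: Qs.
by rewrite -(mulVKg x y).
Qed.

(* The boundary points [y0] and [y1] may coincide. *)
Record cut (A : H -> Prop) (y0 y1 : H) : Prop := Cut {
  cut_ex : exists x, A x;
  cut_out0 : ~ A y0;
  cut_out1 : ~ A y1;
  cut_nbr : forall x s, A x -> S s -> A (x * s) \/ x * s = y0 \/ x * s = y1;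
  cut_coex : exists x, [/\ ~ A x, x <> y0 & x <> y1] }.

(** The opposite side of the separator. It need not be connected; exchanging a side with its [star]
    reduces the positions of two cuts to a few model cases. *)
Definition star (A : H -> Prop) (y0 y1 x : H) : Prop := [/\ ~ A x, x <> y0 & x <> y1].

Lemma cut_swap A y0 y1 : cut A y0 y1 -> cut A y1 y0.
Proof.
case=> e n0 n1 nb [x [x1 x2 x3]]; split=> //; last by exists x.
by move=> z s Az Ss; have := nb z s Az Ss; tauto.
Qed.

Lemma star_swap A y0 y1 : star A y0 y1 = star A y1 y0.
Proof. by apply/funext=> x; apply/propext; split=> -[]. Qed.

Lemma cut_star A y0 y1 : cut A y0 y1 -> cut (star A y0 y1) y0 y1.
Proof.
case=> e n0 n1 nb c; split=> //; [by case..| |].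
- move=> x s [nx x0 x1] Ss.
  have [E0|?] := pselect (x * s = y0); first by right; left.
  have [E1|?] := pselect (x * s = y1); first by right; right.
  left; split=> // /nb /(_ (SV Ss)).
  by rewrite mulgK; tauto.
- case: e => x Ax; exists x; split; first by case.
    by move=> E; move: n0; rewrite -E.
  by move=> E; move: n1; rewrite -E.
Qed.

Lemma starK A y0 y1 : cut A y0 y1 -> star (star A y0 y1) y0 y1 = A.
Proof.
move=> [_ n0 n1 _ _]; apply/funext=> x; apply/propext; split.
  by case=> h x0 x1; apply: contrapT => nA; apply: h.
move=> Ax; split; first by case.
  by move=> E; move: n0; rewrite -E.
by move=> E; move: n1; rewrite -E.
Qed.

Lemma cut_locate A y0 y1 x : cut A y0 y1 -> x <> y0 -> x <> y1 -> A x \/ star A y0 y1 x.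
Proof. by move=> _ x0 x1; case: (pselect (A x)); [left|right]. Qed.

(** Edges come from right multiplication, so left translation is a graph automorphism; this is the
    set [g A]. *)
Definition shift (g : H) (A : H -> Prop) : H -> Prop := fun x => A (g^-1 * x).

Lemma shiftM g h A : shift (g * h) A = shift g (shift h A).
Proof. by apply/funext=> x; rewrite /shift invgM mulgA. Qed.

Lemma shift1 A : shift 1 A = A.
Proof. by apply/funext=> x; rewrite /shift invg1 mul1g. Qed.

Lemma shift_mem g A x : shift g A (g * x) = A x.
Proof. by rewrite /shift mulKg. Qed.

Lemma shift_star g A y0 y1 :
  shift g (star A y0 y1) = star (shift g A) (g * y0) (g * y1).
Proof.
apply/funext=> x; apply/propext; rewrite /shift /star; split=> -[h h0 h1]; split=> //.
- by move=> E; apply: h0; rewrite E mulKg.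
- by move=> E; apply: h1; rewrite E mulKg.
- by move=> E; apply: h0; rewrite -E mulVKg.
- by move=> E; apply: h1; rewrite -E mulVKg.
Qed.

Lemma cut_shift g A y0 y1 : cut A y0 y1 -> cut (shift g A) (g * y0) (g * y1).
Proof.
case=> [[x Ax]] n0 n1 nb [z [z1 z2 z3]]; split; rewrite ?shift_mem //.
- by exists (g * x); rewrite shift_mem.
- move=> v s; rewrite /shift => Av Ss.
  rewrite mulgA; case: (nb _ _ Av Ss) => [|[E|E]]; first by left.
    by right; left; rewrite -E mulgA mulVKg.
  by right; right; rewrite -E mulgA mulVKg.
- exists (g * z); rewrite shift_mem; split=> //; by move/mulgI.
Qed.

Fixpoint walk (k : nat) (x y : H) : Prop :=
  if k is k'.+1 then exists s, S s /\ walk k' (x * s) y else x = y.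

Lemma walk_shift g k x y : walk k x y -> walk k (g * x) (g * y).
Proof.
elim: k x => [|k IH] x /=; first by move->.
by case=> s [Ss w]; exists s; split=> //; rewrite -mulgA; apply: IH.
Qed.

Lemma walk_cross B z0 z1 k x y : cut B z0 z1 -> walk k x y -> B x -> ~ B y ->
  exists i j z, [/\ z = z0 \/ z = z1, walk i x z, walk j z y & (i + j = k)%N].
Proof.
move=> cB; elim: k x => [|k IH] x /=; first by move->.
case=> s [Ss w] Bx nBy; case: (pselect (B (x * s))) => [Bxs|nB].
  have [i [j [z [hz wi wj E]]]] := IH _ w Bxs nBy.
  by exists i.+1, j, z; split=> //; [exists s|rewrite -E].
exists 1%N, k, (x * s); split=> //; last by exists s.
by have := cut_nbr cB Bx Ss; tauto.
Qed.

Lemma walk_rcons s k x y : S s -> walk k x y -> walk k.+1 x (y * s).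
Proof.
move=> Ss; elim: k x => [|k IH] x; first by move=> /= ->; exists s.
by case=> t [St w]; exists t; split=> //; apply: IH.
Qed.

Lemma walk_sym k x y : walk k x y -> walk k y x.
Proof.
elim: k x => [|k IH] x //= [s [Ss /IH w]].
by have := walk_rcons (SV Ss) w; rewrite mulgK.
Qed.

Lemma walk_ex x y : exists k, walk k x y.
Proof.
move: x y; suff h : forall x, exists k, forall z, walk k z (z * x).
  by move=> x y; case: (h (x^-1 * y)) => k /(_ x); rewrite mulVKg; exists k.
apply: S_ind; first by exists 0 => z /=; rewrite mulg1.
move=> x s [k wk] Ss; exists k.+1 => z.
by rewrite mulgA; apply: walk_rcons.
Qed.

(** * Corners of two cuts and nestedness at minimal distance *)

Variable d : nat.
Hypothesis d_min : forall B z0 z1 k, cut B z0 z1 -> walk k z0 z1 -> (d <= k)%N.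
Hypothesis cut_big : forall A y0 y1 z, cut A y0 y1 -> ~ (forall x, A x -> x = z).

(** An outside neighbour of the corner formed by [P] and [Q] lies on one of the two boundaries and
    cannot lie strictly beyond the other; these are the points that remain. *)
Definition corner_nbr P y0 y1 Q z0 z1 (v : H) :=
  ((v = y0 \/ v = y1) /\ (Q v \/ v = z0 \/ v = z1)) \/
  ((v = z0 \/ v = z1) /\ (P v \/ v = y0 \/ v = y1)).

Lemma corner_nbrP P y0 y1 Q z0 z1 x s : cut P y0 y1 -> cut Q z0 z1 ->
  P x -> Q x -> S s -> (P (x * s) /\ Q (x * s)) \/ corner_nbr P y0 y1 Q z0 z1 (x * s).
Proof.
move=> cP cQ Px Qx Ss; rewrite /corner_nbr.
have := cut_nbr cP Px Ss; have := cut_nbr cQ Qx Ss.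
by tauto.
Qed.

Lemma corner_empty0 P y0 y1 Q z0 z1 : cut P y0 y1 -> cut Q z0 z1 ->
  (forall v, ~ corner_nbr P y0 y1 Q z0 z1 v) -> forall x, P x -> Q x -> False.
Proof.
move=> cP cQ nv x Px Qx; have := @closed_full (fun x => P x /\ Q x) x (conj Px Qx).
move=> /(_ _ y0) full; apply: (cut_out0 cP); apply: (proj1 (full _)).
by move=> y s [Py Qy] Ss; case: (corner_nbrP cP cQ Py Qy Ss) => // /nv.
Qed.

(* When a corner has at most one neighbour [w], the pair [(w, w)] would cut at distance 0. *)
Lemma corner_empty1 w P y0 y1 Q z0 z1 : y0 <> y1 -> (0 < d)%N -> cut P y0 y1 -> cut Q z0 z1 ->
  (forall v, corner_nbr P y0 y1 Q z0 z1 v -> v = w) -> forall x, P x -> Q x -> False.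
Proof.
move=> ny d0 cP cQ nv x Px Qx.
case: (pselect (exists v, corner_nbr P y0 y1 Q z0 z1 v)) => [[v hv]|no]; last first.
  by apply: (corner_empty0 cP cQ _ Px Qx) => v hv; apply: no; exists v.
have vw := nv v hv.
have nPQ : ~ (P w /\ Q w).
  rewrite -vw; case: hv => -[] [] -> _ [hP hQ].
  - exact: cut_out0 cP hP.
  - exact: cut_out1 cP hP.
  - exact: cut_out0 cQ hQ.
  - exact: cut_out1 cQ hQ.
suff /d_min/(_ (erefl : walk 0 w w)) : cut (fun x => P x /\ Q x) w w by lia.
split=> //; first by exists x.
- move=> y s [Py Qy] Ss; case: (corner_nbrP cP cQ Py Qy Ss); first by left.
  by move/nv; right; left.
- case: (pselect (y0 = w)) => [E|n0].
    exists y1; rewrite -E; split; try by move/esym.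
    by case=> /(cut_out1 cP).
  by exists y0; split=> //; case=> /(cut_out0 cP).
Qed.

(** Written for disjoint sides only; inclusions between sides are the same relation with one or both
    sides replaced by [star]. *)
Definition nested P y0 y1 Q z0 z1 :=
  [/\ forall x : H, P x -> Q x -> False, ~ Q y0 /\ ~ Q y1 & ~ P z0 /\ ~ P z1].

Lemma nested_sub P y0 y1 Q z0 z1 : nested P y0 y1 Q z0 z1 ->
  (forall x, Q x -> star P y0 y1 x) /\ (forall x, P x -> star Q z0 z1 x).
Proof.
move=> [h [q0 q1] [p0 p1]]; split=> x hx; split.
- by move=> Px; apply: h hx.
- by move=> E; rewrite E in hx.
- by move=> E; rewrite E in hx.
- by move=> Qx; apply: h Qx.
- by move=> E; rewrite E in hx.
- by move=> E; rewrite E in hx.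
Qed.

(** The corners of [P] with [Q] and with [star Q] see only [y0] and only [y1] respectively, so both
    are empty. Then [P] would lie in the boundary of [Q], which is outside [P]. *)
Lemma not_split P y0 y1 Q z0 z1 : cut P y0 y1 -> cut Q z0 z1 -> y0 <> y1 -> (0 < d)%N ->
  Q y0 -> star Q z0 z1 y1 -> star P y0 y1 z0 -> star P y0 y1 z1 -> False.
Proof.
move=> cP cQ ny d0 Q0 Q1 [p0 z00 z01] [p1 z10 z11].
have [x Px] := cut_ex cP.
have e1 := @corner_empty1 y0 _ _ _ _ _ _ ny d0 cP cQ.
have e2 := @corner_empty1 y1 _ _ _ _ _ _ ny d0 cP (cut_star cQ).
case: (pselect (x = z0)) => [E|x0]; first by rewrite E in Px.
case: (pselect (x = z1)) => [E|x1]; first by rewrite E in Px.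
case: (cut_locate cQ x0 x1) => Qx.
- apply: (e1 _ x) => // v; case: Q1 => q1 z10' z11' -[] [] [] -> hh //; exfalso; tauto.
- apply: (e2 _ x) => // v; rewrite /corner_nbr /star; case: Q1 => q1 z10' z11' -[] [] [] -> hh //; exfalso.
  + case: hh => [[]|[E|E]] //; [apply: (cut_out0 cQ)|apply: (cut_out1 cQ)]; by rewrite -E.
  + by tauto.
  + by tauto.
Qed.

Lemma corner_cut a b P y0 y1 Q z0 z1 x : cut P y0 y1 -> cut Q z0 z1 -> P x -> Q x ->
  (forall v, corner_nbr P y0 y1 Q z0 z1 v -> v = a \/ v = b) ->
  ~ (P a /\ Q a) -> ~ (P b /\ Q b) -> (exists c, [/\ ~ (P c /\ Q c), c <> a & c <> b]) ->
  cut (fun x => P x /\ Q x) a b.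
Proof.
move=> cP cQ Px Qx nv na nb hc; split=> //; first by exists x.
move=> y s [Py Qy] Ss; case: (corner_nbrP cP cQ Py Qy Ss); first by left.
by move/nv; right.
Qed.

(** The two corners of [P] are bounded by [y0, z] and by [z, y1], pairs closer than [d], so both are
    empty and [P] is reduced to [z], against [cut_big]. *)
Lemma no_cross_half P y0 y1 Q z z' i j : cut P y0 y1 -> cut Q z z' ->
  Q y0 -> star Q z z' y1 -> P z -> star P y0 y1 z' -> walk i y0 z -> walk j z y1 ->
  (i < d)%N -> (j < d)%N -> False.
Proof.
move=> cP cQ Q0 Q1 Pz Pz' wi wj id jd.
have [n1 n1z n1z'] := Q1; have [m1 m1y m1y'] := Pz'.
have [p0 p1] := (cut_out0 cP, cut_out1 cP); have [q0 q1] := (cut_out0 cQ, cut_out1 cQ).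
have y0z : y0 <> z by move=> E; rewrite E in p0.
have y01 : y0 <> y1 by move=> E; rewrite E in Q0.
apply: (@cut_big P y0 y1 z cP) => x Px; apply: contrapT => xz.
have xz' : x <> z' by move=> E; rewrite E in Px.
case: (cut_locate cQ xz xz') => Qx.
- suff /d_min/(_ wi) : cut (fun x => P x /\ Q x) y0 z by lia.
  apply: (corner_cut cP cQ Px Qx); try tauto.
    by move=> v [] [] [] -> hh; [by left| |by right|]; exfalso; tauto.
  by exists y1; split; [tauto|exact: nesym|].
- suff /d_min/(_ wj) : cut (fun x => P x /\ star Q z z' x) z y1 by lia.
  apply: (corner_cut cP (cut_star cQ) Px Qx); try tauto.
  + move=> v [] [] [] -> hh; [|by right|by left|]; exfalso; last by tauto.
    by move: hh => [[]|[E|E]] //; move: Q0; rewrite E.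
  + by case=> _ [].
  + by exists y0; split; [tauto| |].
Qed.

Lemma no_cross A y0 y1 B z0 z1 : cut A y0 y1 -> cut B z0 z1 -> walk d y0 y1 ->
  B y0 -> star B z0 z1 y1 -> A z0 -> star A y0 y1 z1 -> False.
Proof.
move=> cA cB wd B0 B1 A0 A1; have [n1 n1z n1z'] := B1.
have [i [j [z [hz wi wj E]]]] := walk_cross cB wd B0 n1.
have i0 : (0 < i)%N.
  case: i wi {E} => //= E0; case: hz => E1; rewrite -E0 in E1; rewrite E1 in B0.
    by case: (cut_out0 cB).
  by case: (cut_out1 cB).
have j0 : (0 < j)%N by case: j wj {E} => //= E0; case: hz; rewrite E0.
case: hz => Ez; rewrite Ez in wi wj.
  by apply: (no_cross_half cA cB B0 B1 A0 A1 wi wj); lia.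
(* The geodesic passes through [z1], which lies in [star A]; that side now takes the role of [A]. *)
have cB' := cut_swap cB.
apply: (no_cross_half (cut_star cA) cB' B0 _ A1 _ wi wj); try lia.
  by rewrite star_swap.
by rewrite (starK cA).
Qed.

(** A neighbour of the corner is common to both boundaries, and two different pairs share at most
    one point, so one of the two emptiness lemmas applies. *)
Lemma nestedI P y0 y1 Q z0 z1 : cut P y0 y1 -> cut Q z0 z1 ->
  ~ (y0 = z0 /\ y1 = z1) -> ~ (y0 = z1 /\ y1 = z0) -> walk d y0 y1 -> walk d z0 z1 ->
  ~ Q y0 -> ~ Q y1 -> ~ P z0 -> ~ P z1 -> nested P y0 y1 Q z0 z1.
Proof.
move=> cP cQ nE nE' wy wz q0 q1 p0 p1; split=> // x Px Qx.
case: (posnP d) => [d0|d0].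
  rewrite d0 /= in wy wz; subst y1 z1.
  by apply: (corner_empty0 cP cQ _ Px Qx) => v [] [] [] ->; intuition.
have y01 : y0 <> y1.
  by move=> E; move: cP; rewrite E => /d_min/(_ (erefl : walk 0 y1 y1)); lia.
have z01 : z0 <> z1.
  by move=> E; move: cQ; rewrite E => /d_min/(_ (erefl : walk 0 z1 z1)); lia.
case: (pselect (exists w, (w = y0 \/ w = y1) /\ (w = z0 \/ w = z1))) => [[w hw]|no].
  apply: (corner_empty1 y01 d0 cP cQ (w := w) _ Px Qx) => v hv.
  have {}hv : (v = y0 \/ v = y1) /\ (v = z0 \/ v = z1).
    by case: hv => -[] [] ->; tauto.
  by case: hv => -[] -> []; case: hw => -[] -> []; intuition congruence.
apply: (corner_empty0 cP cQ _ Px Qx) => v hv; apply: no; exists v.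
by case: hv => -[] [] ->; tauto.
Qed.

Lemma boundary_side B z0 z1 y0 y1 : cut B z0 z1 ->
  [\/ ~ B y0 /\ ~ B y1, ~ star B z0 z1 y0 /\ ~ star B z0 z1 y1,
      B y0 /\ star B z0 z1 y1 | B y1 /\ star B z0 z1 y0].
Proof.
move=> cB; have dis x : B x -> ~ star B z0 z1 x by move=> ? [].
case: (pselect (B y0)) => h0; case: (pselect (B y1)) => h1;
  case: (pselect (star B z0 z1 y0)) => g0; case: (pselect (star B z0 z1 y1)) => g1;
  try by [constructor 1]; try by [constructor 2]; try by [constructor 3]; try by [constructor 4].
all: by [case: (dis _ h0)|case: (dis _ h1)].
Qed.

(* If both boundaries are split, a geodesic joining the boundary points of one cut passes through
   a boundary point of the other, and the corners at that point are cuts at smaller distance. *)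
Lemma cuts_nested A y0 y1 B z0 z1 : cut A y0 y1 -> cut B z0 z1 ->
  walk d y0 y1 -> walk d z0 z1 ->
  ~ (y0 = z0 /\ y1 = z1) -> ~ (y0 = z1 /\ y1 = z0) ->
  [\/ nested A y0 y1 B z0 z1, nested A y0 y1 (star B z0 z1) z0 z1,
      nested (star A y0 y1) y0 y1 B z0 z1 |
      nested (star A y0 y1) y0 y1 (star B z0 z1) z0 z1].
Proof.
move=> cA cB wy wz nE nE'.
have [cA' cB'] := (cut_star cA, cut_star cB).
have [sA sB] := (starK cA, starK cB).
have split_false P y y' Q z z' : cut P y y' -> cut Q z z' -> walk d y y' -> Q y -> star Q z z' y' ->
    ~ P z -> ~ P z' -> False.
  move=> cP cQ w Qy Qy' Pz Pz'; have [n1 n2 n3] := Qy'.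
  have yz : y <> z by move=> E; move: (cut_out0 cQ); rewrite -E.
  have yz' : y <> z' by move=> E; move: (cut_out1 cQ); rewrite -E.
  have yy : y <> y' by move=> E; rewrite -E in n1.
  have d0 : (0 < d)%N by case: (d) w.
  apply: (not_split cP cQ yy d0 Qy Qy'); split=> //; exact: nesym.
have [cAs cBs] := (cut_swap cA, cut_swap cB); have [wy' wz'] := (walk_sym wy, walk_sym wz).
have starS (P : H -> Prop) u v x : star P u v x -> star P v u x by rewrite star_swap.
case: (boundary_side y0 y1 cB) => [[b0 b1]|[b0 b1]|[b0 b1]|[b0 b1]];
 case: (boundary_side z0 z1 cA) => [[c0 c1]|[c0 c1]|[c0 c1]|[c0 c1]].
- by constructor 1; apply: nestedI.
- by constructor 3; apply: nestedI.
- by case: (split_false _ _ _ _ _ _ cB cA wz c0 c1).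
- by case: (split_false _ _ _ _ _ _ (cut_swap cB) cA wz' c0 c1).
- by constructor 2; apply: nestedI.
- by constructor 4; apply: nestedI.
- by case: (split_false _ _ _ _ _ _ cB' cA wz c0 c1).
- by case: (split_false _ _ _ _ _ _ (cut_swap cB') cA wz' c0 c1).
- by case: (split_false _ _ _ _ _ _ cA cB wy b0 b1).
- by case: (split_false _ _ _ _ _ _ cA' cB wy b0 b1).
- by case: (no_cross cA cB wy b0 b1 c0 c1).
- by case: (no_cross cA cBs wy b0 (starS _ _ _ _ b1) c0 c1).
- by case: (split_false _ _ _ _ _ _ (cut_swap cA) cB wy' b0 b1).
- by case: (split_false _ _ _ _ _ _ (cut_swap cA') cB wy' b0 b1).
- by case: (no_cross cAs cB wy' b0 b1 c0 (starS _ _ _ _ c1)).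
- by case: (no_cross cAs cBs wy' b0 (starS _ _ _ _ b1) c0 (starS _ _ _ _ c1)).
Qed.
Definition connected (P : H -> Prop) := forall Q : H -> Prop, (exists x, P x /\ Q x) ->
  (forall x s, P x -> Q x -> S s -> P (x * s) -> Q (x * s)) -> forall x, P x -> Q x.

Lemma connected_translate g P : connected P -> connected (fun x => P (g * x)).
Proof.
move=> cP Q [x [Px Qx]] Qs y Py; have := cP (fun z => Q (g^-1 * z)).
move=> /(_ _ _ _ Py); rewrite mulKg; apply.
  by exists (g * x); rewrite mulKg.
move=> z s Pz Qz Ss Pzs; rewrite mulgA; apply: Qs; rewrite // ?mulVKg //.
by rewrite mulgA mulVKg.
Qed.

Lemma cut_component A y0 y1 : cut A y0 y1 -> exists2 A', cut A' y0 y1 & connected A'.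
Proof.
move=> cA; have [a Aa] := cut_ex cA.
pose clos Q := forall x s, A x -> Q x -> S s -> A (x * s) -> Q (x * s).
(* The component of [a] in [A], as the intersection of all sets that contain [a] and are closed
   under steps inside [A]. *)
exists (fun x => A x /\ forall Q : H -> Prop, Q a -> clos Q -> Q x).
  split.
  - by exists a; split.
  - by case=> /(cut_out0 cA).
  - by case=> /(cut_out1 cA).
  - move=> x s [Ax Cx] Ss; case: (cut_nbr cA Ax Ss); last by right.
    by move=> Axs; left; split=> // Q Qa cQ; apply: (cQ) => //; apply: Cx.
  - by have [x [x1 x2 x3]] := cut_coex cA; exists x; split=> //; case.
move=> Q [x [[Ax Cx] Qx]] Qs.
pose C x := A x /\ forall Q : H -> Prop, Q a -> clos Q -> Q x.
have Cstep y s : C y -> S s -> A (y * s) -> C (y * s).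
  move=> [Ay Cy] Ss Ays; split=> // R Ra cR; apply: (cR) => //; exact: Cy.
(* Steps are reversible, so if [Q] missed [a], its complement would be closed and contain the whole
   component. *)
have Qa : Q a.
  apply: contrapT => nQa.
  have [] := Cx (fun z => C z /\ ~ Q z); [by split=> //; split| |by []].
  move=> y s Ay [Cy nQy] Ss Ays; split; first exact: Cstep.
  move=> Qys; apply: nQy.
  by have := Qs (y * s) s^-1 (Cstep _ _ Cy Ss Ays) Qys (SV Ss); rewrite mulgK; apply.
move=> y [Ay Cy].
suff: C y /\ Q y by case.
apply: (Cy (fun y => C y /\ Q y)); first by split=> //; split.
by move=> z s Az [Cz Qz] Ss Azs; split; [apply: Cstep|apply: Qs => //; apply: Cstep].
Qed.

(** * A connected cut at minimal distance, translated to have boundary point [1] *)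

Section MinimalCut.
Variables (A : H -> Prop) (u : H).
Hypotheses (cA : cut A 1 u) (wA : walk d 1 u) (connA : connected A).

(** If the complement of [A] split into two parts, each would contain a boundary point, as the whole
    graph is connected, so [1] and [u] would be in different parts. A part meeting [star A] would
    then be cut off by a single point, so [d = 0] and [1 = u]. *)
Lemma compl_connected : connected (fun x => ~ A x).
Proof.
move=> Q [x [nAx Qx]] Qs y nAy; apply: contrapT => nQy.
pose closed_in R := forall z s, ~ A z -> R z -> S s -> ~ A (z * s) -> R (z * s).
have cs := cut_star cA; have [a Aa] := cut_ex cA.
have out v : v = 1 \/ v = u -> ~ A v by case=> ->; [exact: (cut_out0 cA)|exact: (cut_out1 cA)].
have meets R z : closed_in R -> R z -> ~ A z -> R 1 \/ R u.
  move=> cR Rz nAz; apply: contrapT => nR.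
  have : forall v, ~ A v /\ R v.
    apply: (@closed_full _ z); first by split.
    move=> v s [nAv Rv] Ss.
    have sv : star A 1 u v by split=> // E; apply: nR; rewrite -E; auto.
    have nAvs : ~ A (v * s) by case: (cut_nbr cs sv Ss) => [[]|/out].
    by split=> //; apply: cR.
  by move=> /(_ a) [].
have kill R z w w' : closed_in R -> star A 1 u z -> R z -> R w -> ~ R w' ->
    (w = 1 /\ w' = u \/ w = u /\ w' = 1) -> False.
  move=> cR sz Rz Rw Rw' ww.
  have /d_min/(_ (erefl : walk 0 w w)) : cut (fun x => star A 1 u x /\ R x) w w.
    have wb : w = 1 \/ w = u by tauto.
    split; [by exists z| | | |].
    - by case=> -[_ ? ?]; tauto.
    - by case=> -[_ ? ?]; tauto.
    - move=> v s [sv Rv] Ss; have [nAv _ _] := sv; case: (cut_nbr cs sv Ss) => h.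
        by left; split=> //; apply: cR => //; case: h.
      right; left; have nAvs := out _ h; have := cR _ _ nAv Rv Ss nAvs.
      by case: h => ->; case: ww => -[-> E] //; move: Rw'; rewrite E.
    - exists a; split; first by case=> -[].
        by move=> E; move: (out _ wb); rewrite -E.
      by move=> E; move: (out _ wb); rewrite -E.
  rewrite leqn0 => /eqP d0; move: wA; rewrite d0 /= => E.
  have ww' : w = w' by case: ww => -[-> ->]; [|apply: esym].
  by apply: Rw'; rewrite -ww'.
have cQ : closed_in Q by move=> z s ? ? ? ?; apply: Qs.
have cQ' : closed_in (fun z => ~ Q z).
  move=> z s nAz nQz Ss nAzs Qzs; apply: nQz.
  by have := cQ _ _ nAzs Qzs (SV Ss); rewrite mulgK; apply.
have mQ := meets _ _ cQ Qx nAx; have mQ' := meets _ _ cQ' nQy nAy.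
have [z sz] := cut_ex cs.
case: (pselect (Q z)) => Qz.
  case: mQ mQ' => [q1|qu] [q1'|qu'] //.
    by apply: (kill Q z 1 u) => //; left.
  by apply: (kill Q z u 1) => //; right.
case: mQ mQ' => [q1|qu] [q1'|qu'] //.
  by apply: (kill (fun v => ~ Q v) z u 1) => //; right.
by apply: (kill (fun v => ~ Q v) z 1 u) => //; left.
Qed.

(** Otherwise [u] alone bounds [P]; minimality gives [d = 0], hence [u = 1], and [P] has no boundary
    at all. *)
Lemma cut_nbr1 P : cut P 1 u -> exists2 s, S s & P s.
Proof.
move=> cP; apply: contrapT => no.
have n1 x s : P x -> S s -> x * s <> 1.
  move=> Px Ss E; apply: no; exists s^-1; first exact: SV.
  by rewrite -(mulgK s x) E mul1g in Px.
have cu : cut P u u.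
  split; [exact: cut_ex cP|exact: cut_out1 cP|exact: cut_out1 cP| |].
    by move=> x s Px Ss; case: (cut_nbr cP Px Ss) => [|[/(n1 _ _ Px Ss)|]]; auto.
  by have [x [? _ ?]] := cut_coex cP; exists x.
have := d_min cu (erefl : walk 0 u u); rewrite leqn0 => /eqP d0.
move: wA; rewrite d0 /= => E; have [x Px] := cut_ex cP.
apply: (cut_out0 cP); apply: (closed_full Px) => y s Py Ss.
by case: (cut_nbr cP Py Ss) => // -[|]; rewrite -?E => /(n1 _ _ Py Ss).
Qed.

(** Since the boundary point [s] of the translate lies in [P], only two of the four nested positions
    survive: [s] preserves the direction of the cut or reverses it. *)
Lemma translate_types P s : cut P 1 u -> P s ->
  ((forall x, shift s P x -> P x) /\ (forall x, star P 1 u x -> shift s (star P 1 u) x)) \/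
  (forall x, shift s (star P 1 u) x -> P x).
Proof.
move=> cP Ps.
have n1 : ~ (1 = s * 1 /\ u = s * u).
  by case=> E _; move: (cut_out0 cP); rewrite E mulg1.
have n2 : ~ (1 = s * u /\ u = s * 1).
  by case=> _ E; move: (cut_out1 cP); rewrite E mulg1.
have cB := cut_shift s cP; rewrite shift_star.
have := cuts_nested cP cB wA (walk_shift s wA) n1 n2.
case=> /nested_sub [h1 h2].
- by case: (h2 s Ps) => _; rewrite mulg1.
- by move: (h2 s Ps); rewrite (starK cB) /shift mulVg => /(cut_out0 cP).
- by left; split=> // x /h1; rewrite (starK cP).
- by right=> x /h1; rewrite (starK cP).
Qed.

(** This says that [g A] is properly contained in [A]. *)
Definition expands (g : H) := (forall z, A z -> A (g * z)) /\ exists z, ~ A z /\ A (g * z).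

(** Take neighbours [s] and [t] of [1] on the two sides. If neither moves its own side into itself,
    then [s] maps [star A] into [A] and [t] maps [A] into [star A], so [s * t] moves [A] into
    itself. *)
Lemma expanding_short : exists g, expands g /\ (S g \/ exists s t, [/\ S s, S t & g = s * t]).
Proof.
have cs := cut_star cA.
have [s Ss As] := cut_nbr1 cA; have [t St At] := cut_nbr1 cs.
case: (translate_types cA As) => [[h _]|hs].
  exists s; split; last by left.
  split; first by move=> z Az; apply: h; rewrite shift_mem.
  by exists 1; rewrite mulg1; split=> //; exact: cut_out0 cA.
have := translate_types cs At; rewrite (starK cA) => -[[_ h]|ht].
  exists t^-1; split; last by left; apply: SV.
  split; first by move=> z /h.
  apply: contrapT => no.
  have inv z : A (t^-1 * z) -> A z by move=> Az; apply: contrapT => nAz; apply: no; exists z.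
  (* If [t A] were inside [A], then [t * s] would be a point of [A] adjacent to [t], which lies in
     [star A]. *)
  have Ats : A (t * s) by apply: inv; rewrite mulKg.
  have [nAt t1 tu] := At.
  by have := cut_nbr cA Ats (SV Ss); rewrite mulgK => -[|[]].
exists (s * t); split; last by right; exists s, t.
have st z : A z -> A (s * (t * z)).
  by move=> Az; apply: hs; rewrite shift_mem; apply: ht; rewrite shift_mem.
split; first by move=> z /st; rewrite mulgA.
exists t^-1; rewrite mulgK; split=> // At'.
by have := ht 1; rewrite /shift mulg1 => /(_ At') [].
Qed.

Lemma expgBV (g : H) k m : (k <= m)%N -> g ^+ (m - k) * g ^- m = g ^- k.
Proof. by move=> km; rewrite -{2}(subnKC km) expgnDr invgM mulVKg. Qed.

Lemma expands_iter g z k m : expands g -> (k <= m)%N -> A (g ^+ k * z) -> A (g ^+ m * z).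
Proof.
move=> [h _] /subnK <-; elim: (m - k)%N => [|j IH] Az //.
by rewrite addSn expgS -mulgA; apply/h/IH.
Qed.

Lemma expands_iterV g z k m : expands g -> (k <= m)%N -> A (g ^- m * z) -> A (g ^- k * z).
Proof.
move=> eg km Az; have := @expands_iter g (g ^- m * z) 0 (m - k) eg isT.
by rewrite mul1g mulgA expgBV //; apply.
Qed.

Definition aperiodic (f : H) := forall k, (0 < k)%N -> f ^+ k <> 1.

Lemma aperiodic_inj f k m : aperiodic f -> f ^+ k = f ^+ m -> k = m.
Proof.
move=> af; wlog km : k m / (k <= m)%N => [hw E|E].
  by case: (leqP k m) => [/hw|/ltnW/hw h]; [apply|symmetry; apply: h].
apply/eqP; rewrite eqn_leq km /= leqNgt; apply/negP => lt.
apply: (af (m - k)%N); first by rewrite subn_gt0.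
by rewrite expgnFr // E mulgV.
Qed.

Lemma aperiodicV f : aperiodic f -> aperiodic f^-1.
Proof. by move=> af k k0; rewrite expVgn => /eqP; rewrite invg_eq1 => /eqP; apply: af. Qed.

Lemma expands_aperiodic g : expands g -> aperiodic g.
Proof.
move=> eg k k0 E; have [_ [z [nAz Agz]]] := eg; apply: nAz.
rewrite -(mul1g z) -E; apply: (expands_iter eg k0).
by rewrite expg1.
Qed.

Lemma translates_leave f v K : aperiodic f ->
  ~ (forall k, (K <= k)%N -> f ^+ k * v = 1 \/ f ^+ k * v = u).
Proof.
move=> af h.
have inj k m : f ^+ k * v = f ^+ m * v -> k = m by move/mulIg; apply: aperiodic_inj.
case: (h K (leqnn _)) => E0; case: (h K.+1 (leqnSn _)) => E1;
  case: (h K.+2 (leqW (leqnSn _))) => E2;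
  by [have := inj K K.+1; rewrite E0 E1 => /(_ erefl); lia
     |have := inj K K.+2; rewrite E0 E2 => /(_ erefl); lia
     |have := inj K.+1 K.+2; rewrite E1 E2 => /(_ erefl); lia].
Qed.

(** The intersection of all [g^m A] is closed under steps: a step leaving it would have to land on
    the boundary of [g^m A] for all large [m], but the translates of a point are distinct. As it
    misses [1], it is empty. *)
Lemma expands_inter g x : expands g -> exists k, forall m, (k <= m)%N -> ~ A (g ^- m * x).
Proof.
move=> eg; apply: contrapT => no.
have Dx : forall m, A (g ^- m * x).
  move=> m; apply: contrapT => nA; apply: no; exists m => k mk.
  by move/(expands_iterV eg mk).
suff : forall m, A (g ^- m * 1).
  by move/(_ 0); rewrite expg0 invg1 mul1g => /(cut_out0 cA).
apply: (closed_full (Q := fun z => forall m, A (g ^- m * z)) Dx) => y s Dy Ss m.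
apply: contrapT => nA.
apply: (@translates_leave g^-1 (y * s) m); first exact/aperiodicV/expands_aperiodic.
move=> k mk; rewrite expVgn mulgA.
case: (cut_nbr cA (Dy k) Ss) => //; rewrite -mulgA => /(expands_iterV eg mk) //.
Qed.

(** Dual to the intersection: the union of all [g^-m A] is closed under steps, hence everything. *)
Lemma expands_union g x : expands g -> exists k, forall m, (k <= m)%N -> A (g ^+ m * x).
Proof.
move=> eg; suff [k Ak] : exists k, A (g ^+ k * x).
  by exists k => m km; apply: expands_iter Ak.
have [a Aa] := cut_ex cA.
apply: (closed_full (Q := fun z => exists k, A (g ^+ k * z)) (x := a)).
  by exists 0; rewrite mul1g.
move=> y s [m Ay] Ss; apply: contrapT => no.
apply: (@translates_leave g (y * s) m); first exact: expands_aperiodic.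
move=> k mk; rewrite mulgA.
case: (cut_nbr cA (expands_iter eg mk Ay) Ss) => // Ak; case: no.
by exists k; rewrite mulgA.
Qed.

Lemma expands_inter_seq g (L : seq H) : expands g ->
  exists k, forall m x, (k <= m)%N -> x \in L -> ~ A (g ^- m * x).
Proof.
move=> eg; elim: L => [|y L [k IH]]; first by exists 0.
have [k' hk'] := expands_inter y eg; exists (maxn k k') => m x.
rewrite geq_max inE => /andP[km km'] /orP[/eqP ->|]; [exact: hk'|exact: IH].
Qed.

Lemma expands_union_seq g (L : seq H) : expands g ->
  exists k, forall m x, (k <= m)%N -> x \in L -> A (g ^+ m * x).
Proof.
move=> eg; elim: L => [|y L [k IH]]; first by exists 0.
have [k' hk'] := expands_union y eg; exists (maxn k k') => m x.
rewrite geq_max inE => /andP[km km'] /orP[/eqP ->|]; [exact: hk'|exact: IH].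
Qed.

(** * Ends as families of sets with finite boundary *)

Definition fin_bnd (E : H -> Prop) := exists L : seq H, forall x s, S s ->
  x \notin L -> x * s \notin L -> E x <-> E (x * s).

Lemma fin_bndC E : fin_bnd E -> fin_bnd (fun x => ~ E x).
Proof. by case=> L h; exists L => x s Ss xL xsL; have := h x s Ss xL xsL; tauto. Qed.

Lemma fin_bnd_translate c E : fin_bnd E -> fin_bnd (fun x => E (c * x)).
Proof.
case=> L h; exists [seq c^-1 * x | x <- L] => x s Ss xL xsL; rewrite mulgA.
have mem z : z \notin [seq c^-1 * x | x <- L] -> c * z \notin L.
  by apply: contra => zL; apply/mapP; exists (c * z); rewrite ?mulKg.
by apply: h => //; rewrite -?mulgA; apply: mem.
Qed.

Lemma fin_bnd_translateE c E : fin_bnd (fun x => E (c * x)) <-> fin_bnd E.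
Proof.
split; last exact: fin_bnd_translate.
move/(fin_bnd_translate c^-1); congr fin_bnd.
by apply/funext=> x; rewrite mulVKg.
Qed.

Lemma fin_bnd_cut : fin_bnd A.
Proof.
exists [:: 1; u] => x s Ss; rewrite !inE !negb_or => /andP[/eqP x1 /eqP xu] /andP[/eqP y1 /eqP yu].
split=> h; first by have := cut_nbr cA h Ss; tauto.
by have := cut_nbr cA h (SV Ss); rewrite mulgK; tauto.
Qed.

(* An end is identified with the sets of finite boundary that contain one of its tails. *)
Definition end_functional := (H -> Prop) -> Prop.

Definition lim_pow (f : H) : end_functional :=
  fun E => fin_bnd E /\ exists K, forall k, (K <= k)%N -> E (f ^+ k).

(** The preimage of [E] under left multiplication by [c] is [c^-1 E], so this is the image of the
    end under [c]. *)
Definition act (c : H) (e : end_functional) : end_functional := fun E => e (fun x => E (c * x)).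

Lemma actM c c' e : act (c * c') e = act c (act c' e).
Proof.
by apply/funext=> E; rewrite /act; congr e; apply/funext=> x; rewrite mulgA.
Qed.

Lemma act1 e : act 1 e = e.
Proof. by apply/funext=> E; rewrite /act; congr e; apply/funext=> x; rewrite mul1g. Qed.

Lemma actVE c e e' : act c e = e' -> act c^-1 e' = e.
Proof. by move=> <-; rewrite -actM mulVg act1. Qed.

(** Ultrafilter conditions: deciding every set of finite boundary makes such a family maximal, so an
    inclusion between two of them is an equality. *)
Definition is_end (e : end_functional) := [/\ forall E, e E -> fin_bnd E,
  forall E E', fin_bnd E' -> e E -> (forall x, E x -> E' x) -> e E',
  forall E, fin_bnd E -> e E \/ e (fun x => ~ E x) &
  forall E, e E -> e (fun x => ~ E x) -> False].

Lemma is_end_act c e : is_end e -> is_end (act c e).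
Proof.
case=> h1 h2 h3 h4; split.
- by move=> E /h1 /fin_bnd_translateE.
- by move=> E E' fE' eE sub; apply: h2 eE _ => [|x /sub //]; apply: fin_bnd_translate.
- by move=> E fE; apply: h3; apply: fin_bnd_translate.
- by move=> E; apply: h4.
Qed.

Lemma end_eq e e' : is_end e -> is_end e' -> (forall E, e E -> e' E) -> e = e'.
Proof.
case=> h1 h2 h3 h4 [k1 k2 k3 k4] sub; apply/funext=> E; apply/propext; split=> [/sub //|e'E].
by case: (h3 E (k1 _ e'E)) => // /sub /(k4 _ e'E).
Qed.

Lemma pow_avoid f p (L : seq H) : aperiodic f ->
  exists K, forall k, (K <= k)%N -> f ^+ k * p \notin L.
Proof.
move=> af; elim: L => [|y L [K IH]]; first by exists 0.
case: (pselect (exists k, f ^+ k * p = y)) => [[k0 E]|no].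
  exists (maxn K k0.+1) => k; rewrite geq_max inE negb_or => /andP[Kk k0k].
  rewrite IH // andbT; apply/eqP; rewrite -E => /mulIg /(aperiodic_inj af) ?; lia.
exists K => k Kk; rewrite inE negb_or IH // andbT; apply/eqP => E; apply: no; by exists k.
Qed.

(** [f ^+ k] and [f ^+ k * p] tend to the same end: they are joined by translates of one fixed path,
    which eventually avoid the finite boundary of [E]. *)
Lemma pow_parallel f E p : aperiodic f -> fin_bnd E ->
  exists K, forall k, (K <= k)%N -> E (f ^+ k) <-> E (f ^+ k * p).
Proof.
move=> af [L hL]; elim/S_ind: p => [|p s [K IH] Ss].
  by exists 0 => k _; rewrite mulg1.
have [K1 h1] := pow_avoid p L af; have [K2 h2] := pow_avoid (p * s) L af.
exists (maxn K (maxn K1 K2)) => k; rewrite !geq_max => /and3P[k0 k1 k2].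
rewrite IH // mulgA; apply: hL => //; first exact: h1.
by rewrite -mulgA; apply: h2.
Qed.

Lemma is_end_lim f : aperiodic f -> is_end (lim_pow f).
Proof.
move=> af; split.
- by move=> E [].
- by move=> E E' fE' [_ [K h]] sub; split=> //; exists K => k /h /sub.
(* Taken at [p = f]: membership of [f ^+ k] in [E] is eventually constant in [k]. *)
- move=> E fE; have [K hK] := pow_parallel f af fE.
  have const k : (K <= k)%N -> E (f ^+ k) <-> E (f ^+ K).
    move/subnK <-; elim: (k - K)%N => [|j IH] //.
    rewrite addSn expgSr -hK //; exact: leq_addl.
  case: (pselect (E (f ^+ K))) => EK; [left|right]; split=> //.
  + by exists K => k /const ->.
  + exact: fin_bndC.
  + by exists K => k /const; tauto.
- move=> E [_ [K h]] [_ [K' h']]; apply: (h' (maxn K K')); first exact: leq_maxr.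
  by apply: h; exact: leq_maxl.
Qed.

Lemma act_lim_commute c f : aperiodic f -> commute c f -> act c (lim_pow f) = lim_pow f.
Proof.
move=> af cf; apply: end_eq; [exact/is_end_act/is_end_lim|exact: is_end_lim|].
move=> E [/fin_bnd_translateE fE [K hK]]; split=> //.
have [K' hK'] := pow_parallel c af fE; exists (maxn K K') => k.
rewrite geq_max => /andP[k1 k2]; rewrite hK' // -(commuteX k cf); exact: hK.
Qed.

(** * The two ends of an element moving [A] into itself *)

Section Axis.
Variable g : H.
Hypothesis eg : expands g.
Let wp := lim_pow g.
Let wm := lim_pow g^-1.

Let ag := expands_aperiodic eg.
Let agV := aperiodicV ag.
Let wp_end : is_end wp := is_end_lim ag.
Let wm_end : is_end wm := is_end_lim agV.

Lemma lim_pos : wp A.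
Proof.
split; first exact: fin_bnd_cut.
by have [k hk] := expands_union 1 eg; exists k => m /hk; rewrite mulg1.
Qed.

Lemma lim_neg : wm (fun x => ~ A x).
Proof.
split; first exact/fin_bndC/fin_bnd_cut.
by have [k hk] := expands_inter 1 eg; exists k => m /hk; rewrite mulg1 expVgn.
Qed.

Lemma lim_neq : wp <> wm.
Proof.
move=> E; case: wm_end => _ _ _ /(_ A); apply; last exact: lim_neg.
by rewrite -E; exact: lim_pos.
Qed.

Lemma connected_const P E (L : seq H) x : connected P ->
  (forall x s, S s -> x \notin L -> x * s \notin L -> E x <-> E (x * s)) ->
  (forall y, y \in L -> ~ P y) -> P x -> E x -> forall y, P y -> E y.
Proof.
move=> cP hL PL Px Ex; apply: cP; first by exists x.
move=> y s Py Ey Ss Pys; apply/(hL y s Ss) => //; by apply/negP => /PL.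
Qed.

(** If [e] contains [A], invariance puts every [g^(2k) A] into [e]. For large [k] this connected set
    avoids the boundary of a given [E] in [wp] and contains a high power of [g] lying in [E], so it
    is inside [E]. For [wm] the complements play this role, through [compl_connected]. *)
Lemma end_fixed e : is_end e -> act (g * g) e = e -> e = wp \/ e = wm.
Proof.
move=> ee fe; have [h1 h2 h3 h4] := ee.
have hE E : e (fun x => E (g * g * x)) = e E by rewrite -{2}fe.
case: (h3 A fin_bnd_cut) => eA; [left|right]; symmetry; apply: end_eq => // E [[L hL] [K hK]].
- have ek k : e (fun x => A (g ^- k.*2 * x)).
    elim: k => [|k IH].
      by move: eA; congr e; apply/funext=> x; rewrite expg0 invg1 mul1g.
    rewrite -hE; move: IH; congr e; apply/funext=> x; congr A.
    by rewrite doubleS !expgS mulgA !invgM -!mulgA !mulKg.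
  have [k hk] := expands_inter_seq L eg.
  apply: h2 (ek k) _; first by exists L.
  have [j hj] := expands_union 1 eg.
  apply: (@connected_const _ _ L (g ^+ (k.*2 + maxn j K))) => //.
  + exact: connected_translate.
  + by move=> y /hk; apply; rewrite -addnn leq_addr.
  + by rewrite expgnDr mulKg -(mulg1 (g ^+ _)); apply: hj; exact: leq_maxl.
  + by apply: hK; apply: leq_trans (leq_addl _ _); exact: leq_maxr.
- have ek k : e (fun x => ~ A (g ^+ k.*2 * x)).
    elim: k => [|k IH].
      by move: eA; congr e; apply/funext=> x; rewrite expg0 mul1g.
    move: IH; rewrite -(hE (fun x => ~ A (g ^+ k.*2 * x))); congr e; apply/funext=> x; congr not; congr A.
    by rewrite doubleS !expgSr -!mulgA.
  have [k hk] := expands_union_seq L eg.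
  apply: h2 (ek k) _; first by exists L.
  have [j hj] := expands_inter 1 eg.
  apply: (@connected_const _ _ L (g^-1 ^+ (k.*2 + maxn j K))) => //.
  + exact: (@connected_translate (g ^+ k.*2) _ compl_connected).
  + by move=> y /hk h /(_ (h _ _)); apply; rewrite -addnn leq_addr.
  + rewrite expVgn addnC expgnDr invgM mulVKg -(mulg1 (_^-1)); apply: hj; exact: leq_maxl.
  + by apply: hK; apply: leq_trans (leq_addl _ _); exact: leq_maxr.
Qed.

Definition fixes c := act c wp = wp /\ act c wm = wm.
Definition swaps c := act c wp = wm /\ act c wm = wp.
Definition preserves c := fixes c \/ swaps c.

Lemma fixesM c c' : fixes c -> fixes c' -> fixes (c * c').
Proof. by move=> [a b] [a' b']; split; rewrite actM ?a' ?b'. Qed.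

Lemma fixesV c : fixes c -> fixes c^-1.
Proof. by move=> [a b]; split; apply: actVE. Qed.

Lemma fixes_g : fixes g.
Proof. by split; apply: act_lim_commute => //; apply: commuteV; exact: commute_refl. Qed.

Lemma preservesM c c' : preserves c -> preserves c' -> preserves (c * c').
Proof.
by move=> [] [a b] [] [a' b']; [left|right|right|left]; split; rewrite actM ?a' ?b'.
Qed.

Lemma preservesV c : preserves c -> preserves c^-1.
Proof. by move=> [] [a b]; [left|right]; split; apply: actVE. Qed.

(* [c^-1 g c] preserves the two ends of [g], so [g^2] fixes their images under [c];
   but [g^2] fixes no other ends. *)
Lemma preserves_descent c : preserves (g * c^-1 * g^-1 * c) -> preserves c.
Proof.
move=> p; have pg : preserves g by left; exact: fixes_g.
have pf : preserves (c^-1 * g * c).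
  have /preservesV := preservesM (preservesV pg) p.
  by rewrite -!mulgA mulKg !invgM !invgK -!mulgA.
have fix2 e : e = wp \/ e = wm -> act (g * g) (act c e) = act c e.
  move=> he; have {2}-> : e = act (c^-1 * g * c) (act (c^-1 * g * c) e).
    by case: pf he => -[E1 E2] [] ->; rewrite ?E1 ?E2 ?E1 ?E2.
  have E : g * g * c = c * (c^-1 * g * c) * (c^-1 * g * c) by rewrite -!mulgA !mulVKg.
  by rewrite -!actM E.
have [ep em] : (act c wp = wp \/ act c wp = wm) /\ (act c wm = wp \/ act c wm = wm).
  split; apply: end_fixed; try exact: is_end_act; apply: fix2; by [left|right].
have ne : act c wp <> act c wm.
  by move/(congr1 (act c^-1)); rewrite -!actM mulVg !act1 => /lim_neq.
case: ep em ne => E1 [] E2; rewrite E1 E2 // => _; [left|right]; by split.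
Qed.

(** [A] and [x A] share points near [wp], and their opposite sides share points near [wm];
    nestedness then leaves only the two inclusions. *)
Lemma fixes_comparable x : fixes x ->
  (forall z, A z -> A (x * z)) \/ (forall z, A (x * z) -> A z).
Proof.
move=> fx; have [fp fm] := fixesV fx.
have [v Av Axv] : exists2 v, A v & A (x^-1 * v).
  have [_ [K hK]] := lim_pos.
  have [_ [K' hK']] : wp (fun z => A (x^-1 * z)) by move: lim_pos; rewrite -{1}fp.
  by exists (g ^+ maxn K K'); [apply: hK; exact: leq_maxl|apply: hK'; exact: leq_maxr].
have [w sw sxw] : exists2 w, star A 1 u w & star (shift x A) (x * 1) (x * u) w.
  have [_ [K hK]] := lim_neg.
  have [_ [K' hK']] : wm (fun z => ~ A (x^-1 * z)) by move: lim_neg; rewrite -{1}fm.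
  have [K2 hK2] := pow_avoid 1 [:: 1; u; x * 1; x * u] agV.
  pose k := maxn K (maxn K' K2); exists (g^-1 ^+ k).
  - have := hK2 k; rewrite mulg1 !inE !negb_or => /(_ _)/and4P[].
      by rewrite /k !leq_max leqnn !orbT.
    move=> /eqP ? /eqP ? _ _; split=> //; apply: hK; exact: leq_maxl.
  - have := hK2 k; rewrite mulg1 !inE !negb_or => /(_ _)/and4P[].
      by rewrite /k !leq_max leqnn !orbT.
    move=> _ _ /eqP ? /eqP ?; split=> //; first by apply: hK'; rewrite /k !leq_max leqnn orbT.
case: (pselect (1 = x * 1)) => [|x1].
  by rewrite mulg1 => <-; left=> z; rewrite mul1g.
(* Here [x] exchanges the boundary points, so [x = u] is an involution and [x A] has the same
   boundary as [A]; connectedness of [A] replaces nestedness. *)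
case: (pselect (1 = x * u /\ u = x * 1)) => [[xu]|n2].
  rewrite mulg1 => E; rewrite -E in x1 xu v Av Axv *.
  have uV : u^-1 = u by apply: mulg1_eq.
  left; apply: connA; first by exists v; split=> //; rewrite -{1}uV.
  move=> z s Az Auz Ss Azs; rewrite mulgA; case: (cut_nbr cA Auz Ss) => // -[]; rewrite -mulgA => E'.
    by move: (cut_out1 cA); rewrite -{1}uV; case; rewrite -(mulKg u (z * s)) E' mulg1 in Azs.
  by move: Azs; rewrite -(mulKg u (z * s)) E' mulVg => /(cut_out0 cA).
have cB := cut_shift x cA.
case: (cuts_nested cA cB wA (walk_shift x wA)) => //; first by case.
- by case=> h _ _; case: (h v).
- by move/nested_sub=> [_ h]; right=> z /h; rewrite (starK cB) shift_mem.
- by move/nested_sub=> [h _]; left=> z Az; have := h (x * z); rewrite shift_mem (starK cA); apply.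
- by case=> h _ _; case: (h w).
Qed.

Lemma lim_pos_translate c m : act c wp = wp -> wp (fun x => A (c ^- m * x)).
Proof.
move=> fc; elim: m => [|m IH].
  by move: lim_pos; congr wp; apply/funext=> x; rewrite expg0 invg1 mul1g.
rewrite -fc /act; move: IH; congr wp; apply/funext=> x.
by rewrite expgS invgM -!mulgA mulKg.
Qed.

(* Conjugation by an element swapping the two ends inverts the direction of translation. *)
Lemma swaps_expands h c : swaps h -> fixes c -> expands c -> expands (h * c^-1 * h^-1 * c).
Proof.
move=> sh fc ec; have [h1 h2] := sh; have [c1 c2] := fc.
have fx : fixes (h * c^-1 * h^-1).
  have [i1 i2] := fixesV fc; have [j1 j2] := (actVE h1, actVE h2).
  by split; rewrite !actM ?j1 ?j2 ?i1 ?i2 ?h1 ?h2.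
case: (fixes_comparable fx) => hx.
  have [e1 [z [nz Az]]] := ec; split=> [v /e1 /hx|]; first by rewrite mulgA.
  by exists z; rewrite -mulgA; split=> //; apply: hx.
(* In the other case [c] maps [h^-1 A] into itself. But [c^m A] misses [h^-1 A] for large [m], since
   [h] swaps the ends, while powers of [c] carry any point into [c^m A]. *)
have Bc z : A (h * z) -> A (h * (c * z)).
  by move=> Az; apply: hx; rewrite -!mulgA !mulKg.
have Bck k z : A (h * z) -> A (h * (c ^+ k * z)).
  move=> Az; elim: k => [|k IH]; first by rewrite mul1g.
  by rewrite expgS -mulgA; apply: Bc.
have fB : fin_bnd (fun x => ~ A (h * x)).
  exact: (@fin_bnd_translate h (fun x => ~ A x) (fin_bndC fin_bnd_cut)).
have [L hL] := fB; have [m hm] := expands_inter_seq L ec.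
have [_ [K hK]] := lim_pos_translate m c1.
have [_ [K' hK']] : wp (fun x => ~ A (h * x)).
  by have := lim_neg; rewrite -h1.
have dis : forall z, A (c ^- m * z) -> ~ A (h * z).
  apply: (@connected_const _ _ L (g ^+ maxn K K')) => //.
  - exact: connected_translate.
  - by move=> y /hm; apply.
  - by apply: hK; exact: leq_maxl.
  - by apply: hK'; exact: leq_maxr.
have [a Aa] := cut_ex cA; have [j hj] := expands_union (h^-1 * a) ec.
case: (dis (c ^+ (m + j) * (h^-1 * a))).
  by rewrite expgnDr -mulgA mulKg; apply: hj.
by apply: Bck; rewrite mulVKg.
Qed.

Fixpoint gcomm (k : nat) (x y : H) : H :=
  match k with
  | 0 | 1 => x * y^-1 * x^-1 * y
  | k'.+1 => let c := gcomm k' x y in x * c^-1 * x^-1 * c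
  end.

Lemma gcommSS k x y :
  gcomm k.+2 x y = x * (gcomm k.+1 x y)^-1 * x^-1 * gcomm k.+1 x y.
Proof. by []. Qed.

Lemma gcomm_preserves k h : preserves (gcomm k g h) -> preserves h.
Proof.
elim: k => [|[|k] IH]; try exact: preserves_descent.
by rewrite gcommSS => /preserves_descent.
Qed.

(** With [h] in first place the recursion starts from [g], which expands and fixes both ends;
    commutation with the swapping [h] keeps both properties. *)
Lemma gcomm_swaps k h : swaps h -> expands (gcomm k h g) /\ fixes (gcomm k h g).
Proof.
move=> sh; have base c : fixes c -> expands c ->
    expands (h * c^-1 * h^-1 * c) /\ fixes (h * c^-1 * h^-1 * c).
  move=> fc ec; split; first exact: swaps_expands.
  apply: fixesM => //; have [h1 h2] := sh; have [i1 i2] := fixesV fc.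
  by split; rewrite !actM ?(actVE h1) ?(actVE h2) ?i1 ?i2 ?h1 ?h2.
elim: k => [|[|k] [IH1 IH2]]; apply: base => //; exact: fixes_g.
Qed.

Lemma engel_fixes n : (forall h, S h -> gcomm n g h = 1 /\ gcomm n h g = 1) -> forall x, fixes x.
Proof.
move=> engel; have fix1 : fixes 1 by rewrite /fixes !act1.
have fS h : S h -> fixes h.
  move=> Sh; have [e1 e2] := engel h Sh.
  case: (@gcomm_preserves n h); first by rewrite e1; left.
    by [].
  move/(gcomm_swaps n); rewrite e2 => -[[_ [z []]]].
  by rewrite mul1g.
by apply: S_ind => // x s fx /fS; apply: fixesM.
Qed.
End Axis.

(** * The chain of translates and a generator moving along it *)

Section Chain.
Hypothesis chain : forall x, (forall z, A z -> A (x * z)) \/ (forall z, A (x * z) -> A z).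

(** If no generator expanded, comparability would make every generator, hence every element, map [A]
    into itself; transitivity then gives [1] in [A]. *)
Lemma expanding_generator : exists2 s, S s & expands s.
Proof.
apply: contrapT => no.
have inv s : S s -> forall z, A z -> A (s * z).
  move=> Ss; case: (chain s) => // h.
  have hV z : A z -> A (s^-1 * z) by move=> Az; apply: h; rewrite mulVKg.
  move=> z Az; apply: contrapT => nA; apply: no; exists s^-1; first exact: SV.
  by split=> //; exists (s * z); rewrite mulKg.
have inv' : forall x z, A z -> A (x * z).
  apply: S_ind => [z|x s hx Ss z Az]; first by rewrite mul1g.
  by rewrite -mulgA; apply: hx; apply: inv.
have [a Aa] := cut_ex cA; apply: (cut_out0 cA).
by rewrite -(mulVg a); apply: inv'.
Qed.

Variable s : H.
Hypotheses (Ss : S s) (es : expands s).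

(** Membership in the coset [v <s>], with natural exponents of both signs. *)
Definition pow_rep (x v : H) :=
  (exists k, x = v * s ^+ k) \/ (exists k, x = v * s ^- k).

Lemma expgB_rep v i j : pow_rep (v * s ^+ i * s ^- j) v.
Proof.
case: (leqP j i) => [ji|/ltnW ij].
  by left; exists (i - j)%N; rewrite -mulgA -expgnFr.
by right; exists (j - i)%N; rewrite -{1}(subnK ij) expgnDr invgM -!mulgA mulVKg.
Qed.

(** The coset [x <s>] has points inside and outside [A]: otherwise [chain] would compare [A] with
    all its translates by [x s^m] in one direction, against the exhaustion by powers of [s]. A point
    from which the next power enters [A] is a boundary point. *)
Lemma coset_meets_boundary x : pow_rep x 1 \/ pow_rep x u.
Proof.
have [i Ai] : exists i, A (x * s ^+ i).
  apply: contrapT => no.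
  have h m z : A (x * s ^+ m * z) -> A z.
    case: (chain (x * s ^+ m)) => [hx|]; last by apply.
    have [k /(_ k (leqnn _))] := expands_union 1 es.
    rewrite mulg1 => /hx Ak; case: no; exists (m + k)%N.
    by rewrite expgnDr mulgA.
  have [a Aa] := cut_ex cA; have [k /(_ k (leqnn _))] := expands_inter (x^-1 * a) es.
  by apply; apply: (h k); rewrite -mulgA !mulVKg.
have [j nAj] : exists j, ~ A (x * s ^- j).
  apply: contrapT => no.
  have h m z : A z -> A (x * s ^- m * z).
    case: (chain (x * s ^- m)) => [|hx]; first by apply.
    have [k /(_ k (leqnn _))] := expands_inter 1 es.
    rewrite mulg1 => nA; case: no; exists (k + m)%N => Ak; apply/nA/hx.
    by rewrite -mulgA -invgM -expgnDr.
  have [k /(_ k (leqnn _)) Ak] := expands_union x^-1 es.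
  apply: (cut_out0 cA); have := h k _ Ak.
  by rewrite -mulgA mulKg mulgV.
have [k nAk Ak] : exists2 k, ~ A (x * s ^- j * s ^+ k) & A (x * s ^- j * s ^+ k.+1).
  apply: contrapT => no.
  have nA k : ~ A (x * s ^- j * s ^+ k).
    elim: k => [|k IH]; first by rewrite mulg1.
    by move=> Ak; apply: no; exists k.
  by apply: (nA (j + i)%N); rewrite expgnDr mulgA mulgVK.
have : x * s ^- j * s ^+ k = 1 \/ x * s ^- j * s ^+ k = u.
  have := cut_nbr cA Ak (SV Ss).
  by rewrite expgSr -!mulgA mulgV mulg1 !mulgA; tauto.
have xE v : x * s ^- j * s ^+ k = v -> x = v * s ^+ j * s ^- k.
  move=> <-; rewrite -!mulgA.
  have -> : s ^+ k * (s ^+ j * s ^- k) = s ^+ j.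
    by rewrite mulgA -expgnDr addnC expgnDr mulgK.
  by rewrite mulVg mulg1.
by case=> /xE ->; [left|right]; exact: expgB_rep.
Qed.

(** Unless commutation is immediate, [<s>] having index at most two makes [u * u] commute with [s]
    and [s ^ u] a power [s^k] with [k^2 = 1]. The sign [-1] is excluded: a [u] reversing [s] could
    not make [u A] comparable with [A]. *)
Lemma boundary_commute : commute s u.
Proof.
have as_ := expands_aperiodic es.
have cV k : commute s (s ^- k) by apply: commuteV; apply: commuteX; exact: commute_refl.
have cX k : commute s (s ^+ k) by apply: commuteX; exact: commute_refl.
have rep1 x : pow_rep x 1 -> commute s x by case=> -[k ->]; rewrite mul1g.
have no_inv : s * u <> u * s^-1.
  move=> E; have E' : u * s = s^-1 * u by apply: (mulgI s); rewrite mulVKg mulgA E mulgVK.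
  have Bs z : A (u * (s * z)) -> A (u * z).
    by rewrite mulgA E' -mulgA => /(proj1 es); rewrite mulVKg.
  have Bsk k z : A (u * (s ^+ k * z)) -> A (u * z).
    elim: k z => [|k IH] z; first by rewrite mul1g.
    by rewrite expgSr -mulgA => /IH /Bs.
  case: (chain u) => hu.
    have [k /(_ k (leqnn _)) /hu /Bsk] := expands_union u^-1 es.
    by rewrite mulgV => /(cut_out0 cA).
  have [a Aa] := cut_ex cA; have [k /(_ k (leqnn _))] := expands_inter (u^-1 * a) es.
  by apply; apply: hu; apply: (Bsk k); rewrite !mulVKg.
case: (coset_meets_boundary u^-1) => [/rep1 /commuteV|ruV]; first by rewrite invgK.
have su2 : commute s (u * u).
  suff : commute s (u^-1 * u^-1) by move/commuteV; rewrite invgM !invgK.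
  have: commute s (u^-1 * u^-1) by case: ruV => -[k E]; rewrite {2}E mulKg.
  by [].
case: (coset_meets_boundary (s * u)) => [/rep1 csu|].
  by rewrite -(mulKg s u); apply: commuteM => //; apply: commuteV; exact: commute_refl.
have conj2 : (s ^ u) ^ u = s by rewrite -conjgM conjgE su2 mulKg.
have sqr1 k : s = s ^+ (k * k) -> k = 1%N.
  move=> E; have /(aperiodic_inj as_) : s ^+ 1 = s ^+ (k * k) by rewrite expg1 -E.
  by case: k {E} => // -[|k] //; lia.
case=> -[k E]; have cE : s ^ u = u^-1 * (s * u) by []; rewrite E mulKg in cE.
  move: conj2; rewrite cE conjXg cE -expgnA => /esym /sqr1 k1.
  by rewrite /commute E k1.
move: conj2; rewrite cE conjVg conjXg cE expVgn invgK -expgnA => /esym /sqr1 k1.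
by move: E; rewrite k1.
Qed.
End Chain.
End MinimalCut.
End Cuts.

(** The identities on [gcomm] are what survives of nilpotency in the cover: one entry short, the
    other a generator, in either order. *)
Theorem cut_group_structure (H : groupType) (S : H -> Prop) (n : nat) :
  (forall s, S s -> S s^-1) ->
  (forall Q : H -> Prop, Q 1 -> (forall x s, Q x -> S s -> Q (x * s)) -> forall x, Q x) ->
  (exists a b c, [/\ S a, S b & S c] /\ [/\ a <> b, a <> c & b <> c]) -> ~ S 1 ->
  (forall g h, S g \/ (exists s t, [/\ S s, S t & g = s * t]) -> S h ->
     gcomm n g h = 1 /\ gcomm n h g = 1) ->
  (exists A y0 y1, cut S A y0 y1) ->
  exists s u, [/\ S s, aperiodic s, commute s u &
    forall x, pow_rep s x 1 \/ pow_rep s x u].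
Proof.
move=> SV S_ind [a [b [c [[Sa Sb Sc] [ab ac bc]]]]] nS1 engel [A0 [y0 [y1 c0]]].
pose T k := exists A y0 y1, cut S A y0 y1 /\ walk S k y0 y1.
have Tex : exists k, `[< T k >].
  by have [k w] := walk_ex S_ind y0 y1; exists k; apply/asboolP; exists A0, y0, y1.
case: (ex_minnP Tex) => d /asboolP [A1 [x0 [x1 [c1 w1]]]] dm.
have d_min B z0 z1 k : cut S B z0 z1 -> walk S k z0 z1 -> (d <= k)%N.
  by move=> cB wB; apply: dm; apply/asboolP; exists B, z0, z1.
have cut_big A z0 z1 z : cut S A z0 z1 -> ~ (forall x, A x -> x = z).
  move=> cA Az; have [x Ax] := cut_ex cA; have Ez := Az x Ax; subst x.
  have nb s : S s -> z * s = z0 \/ z * s = z1.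
    move=> Ss; case: (cut_nbr cA Ax Ss) => // /Az E; case: nS1.
    by rewrite -(mulKg z s) E mulVg in Ss.
  have inj s t : z * s = z * t -> s = t by apply: mulgI.
  case: (nb a Sa) => Ea; case: (nb b Sb) => Eb; case: (nb c Sc) => Ec;
    by [apply: ab; apply: inj; rewrite Ea Eb|apply: ac; apply: inj; rewrite Ea Ec
       |apply: bc; apply: inj; rewrite Eb Ec].
(* Neither passing to a component nor translating by [x0^-1] changes the distance between the
   boundary points. *)
have [A2 c2 k2] := cut_component SV c1.
have cA := cut_shift x0^-1 c2; have wA := walk_shift x0^-1 w1.
rewrite mulVg in cA wA; move: (x0^-1 * x1) cA wA => u cA wA.
have connA : connected S (shift x0^-1 A2).
  by have := connected_translate (g := x0) k2; rewrite /shift invgK.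
have [g [eg sg]] := expanding_short SV S_ind d_min cut_big cA wA.
have fx := engel_fixes SV S_ind d_min cut_big cA wA connA eg (fun h => engel g h sg).
have chain x := fixes_comparable SV S_ind d_min cut_big cA wA connA eg (fx x).
have [s Ss es] := expanding_generator SV S_ind cA chain.
exists s, u; split=> //.
- exact: expands_aperiodic es.
- exact: (boundary_commute SV S_ind cA chain Ss es).
- exact: (coset_meets_boundary SV S_ind cA chain Ss es).
Qed.

(** * The group of the local cover *)

Section Words.
Variables (gT : finGroupType) (S : {set gT}) (r : nat).
Hypothesis SV : forall x, x \in S -> x^-1 \in S.
Hypothesis r2 : (1 < r)%N.

Definition letter := {x : gT | x \in S}.

Definition wval (w : seq letter) : gT := foldr (fun x a => val x * a) 1 w.

Lemma wval_cat w w' : wval (w ++ w') = wval w * wval w'.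
Proof. by elim: w => [|x w IH] /=; rewrite ?mul1g // IH mulgA. Qed.

Definition linv (x : letter) : letter := Sub (val x)^-1 (SV (valP x)).

Definition winv (w : seq letter) := rev (map linv w).

Lemma winv_cons x w : winv (x :: w) = winv w ++ [:: linv x].
Proof. by rewrite /winv /= rev_cons cats1. Qed.

Lemma size_winv w : size (winv w) = size w.
Proof. by rewrite size_rev size_map. Qed.

Lemma wval_winv w : wval (winv w) = (wval w)^-1.
Proof.
elim: w => [|x w IH]; first by rewrite invg1.
by rewrite winv_cons wval_cat IH /= mulg1 invMg.
Qed.

(** Insertion of a short relator. A backtrack is a relator of length two, so free reduction is
    included when [1 < r]. *)
Definition wmove (w w' : seq letter) := exists p c q,
  [/\ w = p ++ q, w' = p ++ c ++ q, wval c = 1 & (size c <= r)%N].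

Definition wequiv := clos_refl_sym_trans (seq letter) wmove.

Lemma wequiv_ctx a b w w' : wequiv w w' -> wequiv (a ++ w ++ b) (a ++ w' ++ b).
Proof.
elim=> {w w'} [_ _ [p [c [q [-> -> c1 cr]]]]|w|w w' _|w w' w'' _ h1 _ h2].
- apply: rst_step; exists (a ++ p), c, (q ++ b); split=> //; by rewrite !catA.
- exact: rst_refl.
- exact: rst_sym.
- exact: rst_trans h1 h2.
Qed.

Lemma wequiv_cat w1 w1' w2 w2' : wequiv w1 w1' -> wequiv w2 w2' -> wequiv (w1 ++ w2) (w1' ++ w2').
Proof.
move=> h1 h2; apply: (rst_trans _ _ _ (w1' ++ w2)).
  exact: (@wequiv_ctx [::] w2).
by have := @wequiv_ctx w1' [::] _ _ h2; rewrite !cats0.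
Qed.

Lemma wequiv_short c : wval c = 1 -> (size c <= r)%N -> wequiv [::] c.
Proof. by move=> c1 cr; apply: rst_step; exists [::], c, [::]; split; rewrite ?cats0. Qed.

Lemma wequivV w : wequiv (winv w ++ w) [::].
Proof.
elim: w => [|x w IH]; first exact: rst_refl.
apply: rst_trans IH; rewrite winv_cons -catA.
apply: (@wequiv_cat (winv w) (winv w)); first exact: rst_refl.
apply: (@wequiv_cat [:: linv x; x] [::] w w); last exact: rst_refl.
by apply/rst_sym/wequiv_short => //=; rewrite mulg1 mulVg.
Qed.

Lemma wval_wequiv w w' : wequiv w w' -> wval w = wval w'.
Proof.
elim=> {w w'} [_ _ [p [c [q [-> -> c1 cr]]]]|w|w w' _ ->|w w' w'' _ -> _ ->] //.
by rewrite !wval_cat c1 mul1g.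
Qed.

(** The quotient of words by [wequiv] is hidden behind an existential; everything later uses only
    these three properties of [cls]. *)
Lemma cover_group_ex : exists (H : groupType) (cls : seq letter -> H),
  [/\ forall x, exists w, x = cls w,
      forall w w', cls (w ++ w') = cls w * cls w' &
      forall w w', cls w = cls w' <-> wequiv w w'].
Proof.
pose e : rel (seq letter) := fun w w' => `[< wequiv w w' >].
have er : reflexive e by move=> w; apply/asboolP; exact: rst_refl.
have es : symmetric e by move=> w w'; apply/asboolP/asboolP; exact: rst_sym.
have et : transitive e.
  by move=> w w' w'' /asboolP h1 /asboolP h2; apply/asboolP; exact: rst_trans h1 h2.
pose Q := {eq_quot (EquivRel e er es et)}%qT.
pose cl (w : seq letter) : Q := (\pi_Q w)%qT.
have clE w w' : cl w = cl w' <-> wequiv w w'.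
  by rewrite /cl; split=> [/eqmodP /asboolP //|h]; apply/eqmodP/asboolP.
have reprE x : cl (repr x) = x by rewrite /cl reprK.
pose mu (x y : Q) := cl (repr x ++ repr y).
pose iv (x : Q) := cl (winv (repr x)).
have muE w w' : mu (cl w) (cl w') = cl (w ++ w').
  by apply/clE; apply: wequiv_cat; apply/clE; rewrite reprE.
have muA : associative mu.
  by move=> x y z; rewrite -(reprE x) -(reprE y) -(reprE z) !muE catA.
have mu1 : left_id (cl [::]) mu by move=> x; rewrite -(reprE x) muE.
have mu1r : right_id (cl [::]) mu by move=> x; rewrite -(reprE x) muE cats0.
have muV : left_inverse (cl [::]) iv mu.
  by move=> x; rewrite -{2}(reprE x) /iv muE; apply/clE/wequivV.
have muVr : right_inverse (cl [::]) iv mu.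
  move=> x; have e1 : mu (iv (iv x)) (iv x) = cl [::] by apply: muV.
  by rewrite -(mu1 (mu x (iv x))) -{1}e1 -muA (muA (iv x)) muV mu1.
pose G : groupType := HB.pack_for groupType Q (isGroup.Build Q muA mu1 mu1r muV muVr).
by exists G, cl; split=> // x; exists (repr (x : Q)); rewrite reprE.
Qed.

Section CoverGroup.
Variables (H : groupType) (cls : seq letter -> H).
Hypothesis cls_surj : forall x, exists w, x = cls w.
Hypothesis clsM : forall w w', cls (w ++ w') = cls w * cls w'.
Hypothesis clsE : forall w w', cls w = cls w' <-> wequiv w w'.

Lemma cls_nil : cls [::] = 1.
Proof. by apply: (mulgI (cls [::])); rewrite -clsM mulg1. Qed.

Lemma cls_short w : wval w = 1 -> (size w <= r)%N -> cls w = 1.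
Proof. by move=> w1 wr; rewrite -cls_nil; apply/clsE/rst_sym/wequiv_short. Qed.

Lemma clsV w : cls (winv w) = (cls w)^-1.
Proof.
apply/esym/mulg1_eq; rewrite -clsM -cls_nil.
apply/clsE; rewrite -{1}(_ : winv (winv w) = w); first exact: wequivV.
rewrite /winv map_rev revK -map_comp map_id_in // => x _.
by apply: val_inj; rewrite /= invgK.
Qed.

(** The covering projection as a homomorphism, evaluated on a chosen word; [proj_cls] shows
    independence of the choice. *)
Definition proj (x : H) : gT := wval (sval (cid (cls_surj x))).

Lemma proj_cls w : proj (cls w) = wval w.
Proof. by rewrite /proj; case: cid => w' /= /clsE /wval_wequiv. Qed.

Lemma projM x y : proj (x * y) = proj x * proj y.
Proof.
by have [w ->] := cls_surj x; have [w' ->] := cls_surj y; rewrite -clsM !proj_cls wval_cat.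
Qed.

Lemma proj_one : proj 1 = 1.
Proof. by rewrite -cls_nil proj_cls. Qed.

Definition cgen (x : H) := exists s, x = cls [:: s].

Lemma cgenV x : cgen x -> cgen x^-1.
Proof. by case=> s ->; exists (linv s); rewrite -clsV. Qed.

Lemma cgen_ind (Q : H -> Prop) : Q 1 ->
  (forall x s, Q x -> cgen s -> Q (x * s)) -> forall x, Q x.
Proof.
move=> Q1 Qs x; have [w ->] := cls_surj x; elim/last_ind: w => [|w s IH].
  by rewrite cls_nil.
by rewrite -cats1 clsM; apply: Qs => //; exists s.
Qed.

(** * Iterated commutators as short relators *)

Fixpoint wcomm (k : nat) (a b : seq letter) : seq letter :=
  match k with
  | 0 | 1 => a ++ winv b ++ winv a ++ b
  | k'.+1 => let c := wcomm k' a b in a ++ winv c ++ winv a ++ c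
  end.

Lemma cls_wcomm k a b : cls (wcomm k a b) = gcomm k (cls a) (cls b).
Proof.
elim: k => [|[|k] IH]; rewrite ?[wcomm _.+2 _ _]/= ?gcommSS;
  by rewrite /= !clsM !clsV ?IH !mulgA.
Qed.

Lemma wval_wcomm k a b : wval (wcomm k a b) = comm_iter k (wval a) (wval b).
Proof.
elim: k => [|[|k] IH]; by rewrite /= !wval_cat !wval_winv ?IH !mulgA.
Qed.

(** From one level to the next a length [L] becomes at most [2 * L + 4]; adding 4 turns this into
    doubling, and the first level gives [6 + 4 = 5 * 2]. *)
Lemma size_wcomm k a b : (size a <= 2)%N -> (size b <= 2)%N -> (size a + size b <= 3)%N ->
  (size (wcomm k.+1 a b) + 4 <= 5 * 2 ^ k.+1)%N.
Proof.
move=> sa sb sab; elim: k => [|k IH]; first by rewrite /= !size_cat !size_winv; lia.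
rewrite (_ : wcomm k.+2 a b = a ++ winv (wcomm k.+1 a b) ++ winv a ++ wcomm k.+1 a b) //.
by rewrite !size_cat !size_winv expnS; lia.
Qed.

Lemma comm_iter_commute k (g h : gT) : commute g h -> comm_iter k g h = 1.
Proof.
move=> gh; have c1 : g * h^-1 * g^-1 * h = 1.
  by rewrite (commuteV gh) mulgK mulVg.
by elim: k => [|[|k] IH] //; rewrite [comm_iter _ _ _]/= -/(comm_iter k.+1 g h) IH invg1 !mulg1 mulgV.
Qed.

(** By its length the commutator word is a relator once its value is trivial. [nil_class_le] covers
    inequivalent entries; equivalent ones commute. *)
Lemma gcomm1 n a b : nil_class_le gT n.+1 -> (4 ^ n.+2 <= r)%N ->
  (size a <= 2)%N -> (size b <= 2)%N -> (size a + size b <= 3)%N ->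
  gcomm n.+1 (cls a) (cls b) = 1.
Proof.
move=> nil nr sa sb sab; rewrite -cls_wcomm; apply: cls_short.
  rewrite wval_wcomm; case: (eqVneq (wval a) (wval b)) => [->|ab].
    exact/comm_iter_commute/commute_refl.
  case: (eqVneq (wval a) (wval b)^-1) => [->|abV]; last exact: nil.
  exact/comm_iter_commute/commute_sym/commuteV/commute_refl.
have := size_wcomm n sa sb sab; have : (5 * 2 ^ n.+1 <= 4 ^ n.+2)%N; last by lia.
rewrite (expnMn 2 2) expnS [X in (_ <= X * _)%N]expnS; have : (0 < 2 ^ n)%N by rewrite expn_gt0.
by rewrite !expnS; nia.
Qed.
End CoverGroup.
End Words.

(** * From a cut of the cover to the structure of the group *)

Definition cyclic_times_le2 (gT : finGroupType) (r : nat) : Prop :=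
  exists (i j : nat) (A B : {group gT}),
    (r < i)%N /\ (j = 1 \/ j = 2)%N /\ cyclic A /\ cyclic B /\
    #|A| = i /\ #|B| = j /\ A \x B = [set: gT].

Lemma cyclic_case (gT : finGroupType) (r : nat) (a : gT) :
  (r < #|[set: gT]|)%N -> <[a]> = [set: gT] -> cyclic_times_le2 gT r.
Proof.
move=> rG aG; exists #[a], 1%N, <[a]>%G, 1%G.
refine (conj _ (conj (or_introl erefl) (conj _ (conj _ (conj _ (conj _ _)))))) => //.
- by rewrite /order aG.
- exact: cycle_cyclic.
- exact: cyclic1.
- exact: cards1.
- by rewrite dprodg1.
Qed.

(** If [b] is outside [<a>], then [b * b = a ^+ k], and [b] is corrected to [c = b * a ^- k./2]. For
    odd [k] this [c] is a square root of [a] and generates; for even [k] it is an involution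
    complementing [<a>]. *)
Lemma rank_le2_case (gT : finGroupType) (r : nat) (a b : gT) :
  commute a b -> (r < #[a])%N -> (forall x, x \in <[a]> \/ b^-1 * x \in <[a]>) ->
  cyclic_times_le2 gT r.
Proof.
move=> ab ra cover.
have rG : (r < #|[set: gT]|)%N by apply: leq_trans ra _; apply: subset_leq_card; exact: subsetT.
case: (boolP (b \in <[a]>)) => [ba|nba].
  apply: (@cyclic_case _ _ a) => //; apply/setP=> x; rewrite inE.
  by case: (cover x) => // h; rewrite -(mulKVg b x) groupM.
have b2 : b * b \in <[a]>.
  case: (cover (b * b)) => //; rewrite mulKg => h; by rewrite h in nba.
have [k bk] := cycleP _ _ b2.
have coverb c : b^-1 * c \in <[a]> -> forall x, x \in <[a]> \/ c^-1 * x \in <[a]>.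
  move=> h x; case: (cover x) => hx; [by left|right].
  have -> : c^-1 * x = (b^-1 * c)^-1 * (b^-1 * x) by rewrite invMg invgK -mulgA mulKVg.
  by rewrite groupM ?groupV.
case: (boolP (odd k)) => ok.
  pose c := b * a ^- k./2.
  have c2 : c * c = a.
    have cm : commute b (a ^- k./2) by apply/commuteV/commuteX/commute_sym.
    rewrite /c mulgA -(mulgA b) -cm -!mulgA mulgA bk -invMg -expgD addnn.
    rewrite -{1}(odd_double_half k) ok expgD mulgK //.
  apply: (@cyclic_case _ _ c) => //; apply/setP=> x; rewrite inE.
  have ac : <[a]> \subset <[c]> by rewrite cycle_subG -c2 groupM ?cycle_id.
  have bc : b \in <[c]>.
    by rewrite -(mulgKV (a ^+ k./2) b) groupM ?cycle_id ?groupX // (subsetP ac) ?cycle_id.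
  by case: (cover x) => /(subsetP ac) // h; rewrite -(mulKVg b x) groupM.
pose c := b * a ^- k./2.
have cm : commute b (a ^- k./2) by apply/commuteV/commuteX/commute_sym.
have c2 : c * c = 1.
  rewrite /c mulgA -(mulgA b) -cm -!mulgA mulgA bk -invMg -expgD addnn.
  by rewrite -{1}(odd_double_half k) (negbTE ok) mulgV.
have nca : c \notin <[a]>.
  apply: contra nba => ca; rewrite -(mulgKV (a ^+ k./2) b) groupM ?groupX ?cycle_id //.
have oc : #[c] = 2%N.
  apply: nt_prime_order => //; last by apply: contraNneq nca => ->; exact: group1.
have ca : commute a c by apply: commuteM => //; apply/commuteV/commuteX/commute_refl.
exists #[a], 2%N, <[a]>%G, <[c]>%G; 
refine (conj _ (conj (or_intror erefl) (conj _ (conj _ (conj _ (conj _ _)))))) => //;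
  try exact: cycle_cyclic.
have tri : <[a]> :&: <[c]> = 1.
  by rewrite setIC prime_TIg -?orderE ?oc // cycle_subG.
rewrite dprodE //; last by rewrite cent_cycle cycle_subG; apply/cent1P/commute_sym.
apply/setP=> x; rewrite inE.
have cA : b^-1 * c \in <[a]> by rewrite /c mulKg groupV groupX ?cycle_id.
case: (coverb c cA x) => h.
  by rewrite -(mulg1 x) mem_mulg // group1.
have cj : commute c (c^-1 * x).
  by have [m ->] := cycleP _ _ h; apply/commuteX/commute_sym.
by rewrite -(mulKVg c x) cj mem_mulg // cycle_id.
Qed.

(** Apart from the cyclic cases the generators are two involutions [a] and [b]. Then [[a, b]_n] is
    the power [2 ^ n] of [a * b], so this dihedral group has order at most [2 * 2 ^ n], too small
    for the assumption. *)
Lemma small_valency_case (gT : finGroupType) (S : {set gT}) (n r : nat) :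
  generating_set S -> (#|S| <= 2)%N -> nil_class_le gT n -> (1 <= n)%N -> (4 ^ n.+1 <= r)%N ->
  (r < #|[set: gT]|)%N -> cyclic_times_le2 gT r.
Proof.
move=> [S1 [SV Sg]] cS nil n1 nr rG.
have cyc a : S \subset [set a; a^-1] -> cyclic_times_le2 gT r.
  move=> Sa; apply: (@cyclic_case _ _ a) => //; apply/eqP.
  rewrite eqEsubset subsetT -Sg gen_subG; apply: subset_trans Sa _.
  by apply/subsetP=> x; rewrite !inE => /orP[] /eqP ->; rewrite ?groupV cycle_id.
have [S0|[a aS]] := set_0Vmem S; first by apply: (cyc 1); rewrite S0 sub0set.
case: (boolP (S \subset [set a; a^-1])) => [/cyc //|/subsetPn [b bS]].
rewrite !inE negb_or => /andP[ba baV].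
have SE : S = [set a; b].
  by apply/eqP; rewrite eq_sym eqEcard subUset !sub1set aS bS cards2 eq_sym ba.
have aV : a^-1 = a.
  by have := SV a aS; rewrite SE !inE => /orP[/eqP //|/eqP E]; rewrite E eqxx in baV.
have bV : b^-1 = b.
  have := SV b bS; rewrite SE !inE => /orP[|/eqP //]; by rewrite eqg_invLR (negbTE baV).
pose c := a * b.
have aa : a * a = 1 by rewrite -{1}aV mulVg.
have conjc : c ^ a = c^-1 by rewrite conjgE /c invMg aV bV !mulgA aa mul1g.
have conjcV m : a * c ^- m * a = c ^+ m.
  by rewrite -{1}aV -mulgA -conjgE conjVg conjXg conjc expVgn invgK.
have cE k : comm_iter k.+1 a b = c ^+ (2 ^ k.+1).
  elim: k => [|k IH]; first by rewrite /= aV bV expn1 expgS expg1 /c !mulgA.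
  by rewrite [LHS]/= -/(comm_iter k.+1 a b) IH aV conjcV -expgD addnn -mul2n -expnS.
have c1 : c ^+ (2 ^ n) = 1.
  by have := cE n.-1; rewrite prednK // => <-; apply: nil; rewrite ?bV eq_sym.
have : (#|[set: gT]| <= 2 * 2 ^ n)%N.
  have sub : [set: gT] \subset <[a]> * <[c]>.
    rewrite -norm_joinEl; last by rewrite norms_cycle conjc groupV cycle_id.
    rewrite -Sg gen_subG SE subUset !sub1set mem_gen ?inE ?cycle_id //=.
    rewrite -(mulKg a b) aV -/c groupM // mem_gen // inE cycle_id ?orbT //.
  apply: leq_trans (subset_leq_card sub) _.
  apply: leq_trans (leq_pmulr _ (cardG_gt0 (<[a]> :&: <[c]>)%G)) _.
  rewrite -mul_cardG; apply: leq_mul; apply: dvdn_leq; rewrite ?expn_gt0 // order_dvdn ?c1 //.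
  by rewrite expgS expg1 aa.
have : (2 * 2 ^ n <= 4 ^ n.+1)%N; last by lia.
by rewrite (expnMn 2 2) -expnS leq_pmulr // expn_gt0.
Qed.

Lemma wval_span (gT : finGroupType) (S : {set gT}) (x : gT) :
  generating_set S -> exists w : seq (letter S), x = wval w.
Proof.
move=> [_ [SV Sg]]; have : x \in <<S>> by rewrite Sg inE.
move/gen_prodgP=> [k [c cS ->]].
exists [seq Sub (c i) (cS i) | i <- index_enum 'I_k].
by elim: (index_enum 'I_k) => [|i s IH]; rewrite ?big_nil ?big_cons //= IH.
Qed.

Lemma cover_cut_case (gT : finGroupType) (S : {set gT}) (n r : nat) (H : groupType)
    (cls : seq (letter S) -> H) :
  generating_set S -> nil_class_le gT n -> (1 <= n)%N -> (4 ^ n.+1 <= r)%N -> (20 <= r)%N ->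
  (r < #|[set: gT]|)%N ->
  (forall x, exists w, x = cls w) -> (forall w w', cls (w ++ w') = cls w * cls w') ->
  (forall w w', cls w = cls w' <-> wequiv r w w') ->
  (exists A y0 y1, cut (cgen cls) A y0 y1) -> cyclic_times_le2 gT r.
Proof.
move=> genS nil n1 nr r20 rG surj clsM clsE hcut.
case: (leqP #|S| 2) => [S2|S3]; first exact: small_valency_case genS S2 nil n1 nr rG.
have [S1 [SV Sg]] := genS; have r2 : (1 < r)%N by lia.
have gV := cgenV SV r2 clsM clsE.
have gI := cgen_ind surj clsM.
have [a [b [c [[Sa Sb Sc] [ab ac bc]]]]] : exists a b c : gT,
    [/\ a \in S, b \in S & c \in S] /\ [/\ a <> b, a <> c & b <> c].
  have /card_gt2P [a [b [c [hS [ab bc ca]]]]] := S3.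
  by exists a, b, c; split=> //; split; apply/eqP=> //; rewrite eq_sym.
have three : exists a b c, [/\ cgen cls a, cgen cls b & cgen cls c] /\ [/\ a <> b, a <> c & b <> c].
  pose s x (xS : x \in S) : letter S := Sub x xS.
  exists (cls [:: s a Sa]), (cls [:: s b Sb]), (cls [:: s c Sc]).
  split; first by split; eexists.
  by split=> /clsE /wval_wequiv; rewrite /= !mulg1.
have no1 : ~ cgen cls 1.
  case=> s; rewrite -(cls_nil clsM) => /clsE /wval_wequiv /=; rewrite mulg1 => E.
  by move: S1; rewrite E (valP s).
case: n nil n1 nr => // n nil _ nr.
have engel g h : cgen cls g \/ (exists s t, [/\ cgen cls s, cgen cls t & g = s * t]) ->
    cgen cls h -> gcomm n.+1 g h = 1 /\ gcomm n.+1 h g = 1.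
  move=> hg [t ->]; have [w wg gw] : exists2 w, (size w <= 2)%N & g = cls w.
    case: hg => [[s ->]|[_ [_ [[s ->] [s' ->] ->]]]]; first by exists [:: s].
    by exists [:: s; s'] => //; rewrite -clsM.
  by rewrite gw; split; apply: (gcomm1 SV r2 clsM clsE) => //=; lia.
have [s [u [[s0 sE] as_ su cov]]] := cut_group_structure gV gI three no1 engel hcut.
pose a0 := val s0; have ps : proj surj s = a0 by rewrite sE (proj_cls surj clsE) /= mulg1.
have pM x y := projM surj clsM clsE x y.
have p1 := proj_one surj clsM clsE.
have pX x k : proj surj (x ^+ k) = proj surj x ^+ k.
  by elim: k => [|k IH]; rewrite ?expg0 // !expgS pM IH.
have pV x : proj surj x^-1 = (proj surj x)^-1.
  by apply: (mulIg (proj surj x)); rewrite -pM !mulVg p1.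
apply: (@rank_le2_case _ _ a0 (proj surj u)).
- by rewrite /commute -ps -!pM su.
(* If the order were at most [r], the letter [s0] repeated that many times would be a relator, and
   [s] would have finite order. *)
- rewrite ltnNge; apply/negP => ar; apply: (as_ #[a0]); first exact: order_gt0.
  have -> : s ^+ #[a0] = cls (nseq #[a0] s0).
    rewrite sE; elim: #[a0] => [|k IH]; first by rewrite (cls_nil clsM).
    by rewrite expgS IH -clsM.
  apply: (cls_short clsM clsE); last by rewrite size_nseq.
  have -> : forall k, wval (nseq k s0) = a0 ^+ k by elim=> [|k IH] //=; rewrite IH -expgS.
  exact: expg_order.
- move=> x; have [w xw] := wval_span x genS.
  have <- : proj surj (cls w) = x by rewrite (proj_cls surj clsE).
  case: (cov (cls w)) => -[] [k ->]; [left|left|right|right];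
    by rewrite pM ?pV pX ps ?p1 ?mul1g ?mulKg ?groupV groupX ?cycle_id.
Qed.

(** * Lifting local separators *)

Section Walks.
Variables (gT : finGroupType) (S : {set gT}).
Hypothesis SV : forall x, x \in S -> x^-1 \in S.

(** The walk spelled by [w] from [v], without its first vertex, as [path] expects; it translates
    words into the vertex sequences of the graph definitions. *)
Fixpoint vpath (v : gT) (w : seq (letter S)) : seq gT :=
  if w is s :: w' then v * val s :: vpath (v * val s) w' else [::].

Lemma vpath_cat v w w' : vpath v (w ++ w') = vpath v w ++ vpath (v * wval w) w'.
Proof.
elim: w v => [|s w IH] v /=; first by rewrite mulg1.
by rewrite IH mulgA.
Qed.

Lemma size_vpath v w : size (vpath v w) = size w.
Proof. by elim: w v => [|s w IH] v //=; rewrite IH. Qed.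

Lemma last_vpath v w : last v (vpath v w) = v * wval w.
Proof. by elim: w v => [|s w IH] v /=; rewrite ?mulg1 // IH mulgA. Qed.

Lemma path_vpath v w : path (cayley S) v (vpath v w).
Proof. by elim: w v => [|s w IH] v //=; rewrite IH andbT /cayley mulKg (valP s). Qed.

Lemma path_word v t : path (cayley S) v t -> exists w, t = vpath v w.
Proof.
elim: t v => [|x t IH] v /=; first by exists [::].
case/andP=> vx /IH [w ->]; exists (Sub (v^-1 * x) vx :: w) => /=.
by rewrite mulKVg.
Qed.

Lemma cayley_sym x y : cayley S x y = cayley S y x.
Proof.
by apply/idP/idP; rewrite /cayley => /SV; rewrite invMg invgK.
Qed.

Lemma mem_vpath v w x : x \in v :: vpath v w -> exists2 i, (i <= size w)%N & x = v * wval (take i w).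
Proof.
elim: w v => [|s w IH] v; first by rewrite inE => /eqP ->; exists 0; rewrite //= mulg1.
rewrite inE => /orP[/eqP ->|/IH [i iw ->]]; first by exists 0; rewrite //= mulg1.
by exists i.+1 => //=; rewrite mulgA.
Qed.

Lemma vpath_take_mem v w i : v * wval (take i w) \in v :: vpath v w.
Proof.
elim: w v i => [|s w IH] v [|i] /=; rewrite ?mulg1 ?inE ?eqxx //.
by apply/orP; right; rewrite mulgA; apply: IH.
Qed.

Lemma vpath_edge v c1 s c2 :
  (v * wval c1, v * wval c1 * val s) \in
    zip (v :: vpath v (c1 ++ s :: c2)) (vpath v (c1 ++ s :: c2)).
Proof.
elim: c1 v => [|t c1 IH] v /=; first by rewrite mulg1 inE eqxx.
by rewrite inE; apply/orP; right; rewrite mulgA; apply: IH.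
Qed.
End Walks.

Section LocalCut.
Variables (gT : finGroupType) (S : {set gT}) (r : nat).
Hypothesis SV : forall x, x \in S -> x^-1 \in S.
Hypothesis r2 : (1 < r)%N.
Variables (H : groupType) (cls : seq (letter S) -> H).
Hypothesis cls_surj : forall x, exists w, x = cls w.
Hypothesis clsM : forall w w', cls (w ++ w') = cls w * cls w'.
Hypothesis clsE : forall w w', cls w = cls w' <-> wequiv r w w'.

Lemma cls_loop c : wval c = 1 -> (size c <= r)%N -> cls c = 1.
Proof. exact: (cls_short clsM clsE). Qed.

Lemma cls_half c c' : wval c = wval c' -> (size c + size c' <= r)%N -> cls c = cls c'.
Proof.
move=> E sz; apply: divg1_eq; rewrite -(clsV SV r2 clsM clsE) -clsM.
by apply: cls_loop; rewrite ?wval_cat ?wval_winv ?E ?mulgV ?size_cat ?size_winv.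
Qed.

(** A short closed walk lifts to a closed walk of the cover, so either of its arcs joins the two
    points; the shorter one has length at most half of [r]. *)
Lemma arc x c i j : wval c = 1 -> (size c <= r)%N -> (i <= size c)%N -> (j <= size c)%N ->
  exists2 d, x * cls (take j c) = x * cls (take i c) * cls d & (size d + size d <= r)%N.
Proof.
move=> c1 cr; have cc := cls_loop c1 cr.
have forward i' j' : (i' <= j')%N -> (j' <= size c)%N ->
    exists2 d, x * cls (take j' c) = x * cls (take i' c) * cls d & (size d + size d <= r)%N.
  move=> ij js; pose f := take (j' - i') (drop i' c).
  have fE : take j' c = take i' c ++ f.
    by rewrite /f -{1}(cat_take_drop i' (take j' c)) take_takel // take_drop subnK.
  have sf : size f = (j' - i')%N by rewrite size_takel // size_drop; lia.
  case: (leqP (size f + size f) r) => [fr|rf].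
    by exists f; rewrite // fE clsM mulgA.
  exists (winv SV (drop j' c ++ take i' c)).
    rewrite (clsV SV r2 clsM clsE) clsM invMg -!mulgA mulKVg; congr (_ * _).
    by apply: (mulIg (cls (drop j' c))); rewrite mulVg -clsM cat_take_drop.
  by rewrite size_winv size_cat size_drop size_takel; lia.
move=> ic jc; case: (leqP i j) => [ij|/ltnW ji]; first exact: forward.
have [d E sd] := forward _ _ ji ic; exists (winv SV d); last by rewrite size_winv.
by rewrite E (clsV SV r2 clsM clsE) mulgK.
Qed.

Variables (v0 v1 : gT) (p : seq (letter S)).
Hypothesis v1E : v1 = v0 * wval p.
Hypothesis p_short : (size p + size p <= r)%N.
(** [col] is a colour class of neighbours of the separator, a union of components of the
    connectivity graph; [R v] extends it over the punctured ball at [v]. A cutvertex is the case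
    [v0 = v1] with [p] empty. *)
Variables (col : gT -> Prop) (R : gT -> gT -> Prop).
Let e := cayley S.
Hypothesis R_edge : forall v x y, v \in [:: v0; v1] -> ball_edge e r v x y ->
  x \notin [:: v0; v1] -> y \notin [:: v0; v1] -> R v x <-> R v y.
Hypothesis R_col : forall v x, v \in [:: v0; v1] -> ball_vertex e r v x ->
  x \notin [:: v0; v1] -> e v0 x || e v1 x -> R v x <-> col x.

Let sg s := cls [:: s].
(** [1] and [x1] form one lift of the separator, and [pr] is the covering map based at [v0]. *)
Let x1 := cls p.
Let pr x := v0 * proj cls_surj x.
Let Y x := (x == 1) || (x == x1).

Lemma prM x w : pr (x * cls w) = pr x * wval w.
Proof. by rewrite /pr (projM cls_surj clsM clsE) (proj_cls cls_surj clsE) mulgA. Qed.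

Lemma pr_1 : pr 1 = v0.
Proof. by rewrite /pr (proj_one cls_surj clsM clsE) mulg1. Qed.

Lemma pr_Y x : Y x -> pr x \in [:: v0; v1].
Proof.
case/orP=> /eqP ->; first by rewrite pr_1 inE eqxx.
by rewrite -(mul1g x1) prM pr_1 -v1E !inE eqxx orbT.
Qed.

(* Crossings, mod 2, between a lifted separator point and the colour class [col]. *)
Definition theta (x y : H) : bool :=
  if Y x then ~~ Y y && `[< col (pr y) >] else Y y && `[< col (pr x) >].

Fixpoint par (x : H) (w : seq (letter S)) : bool :=
  if w is s :: w' then theta x (x * sg s) (+) par (x * sg s) w' else false.

Lemma par_cat x w w' : par x (w ++ w') = par x w (+) par (x * cls w) w'.
Proof.
elim: w x => [|s w IH] x /=; first by rewrite (cls_nil clsM) mulg1.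
by rewrite IH addbA -mulgA -clsM.
Qed.

(* Two lifts on a common short closed walk, one of them in [Y]: the other lies in [Y] as soon as
   its projection does, since the shorter arc and [p] together form a relator. *)
Lemma Y_pr x c i j : wval c = 1 -> (size c <= r)%N -> (i <= size c)%N -> (j <= size c)%N ->
  Y (x * cls (take i c)) -> pr (x * cls (take j c)) \in [:: v0; v1] -> Y (x * cls (take j c)).
Proof.
move=> c1 cr ic jc; have [d -> sd] := arc x c1 cr ic jc.
move: (x * cls _) => y Yy; rewrite prM !inE.
case/orP: Yy => /eqP ->.
  rewrite pr_1 mul1g => /orP[] /eqP E.
    by rewrite /Y cls_loop ?eqxx //; [apply: (mulgI v0); rewrite E mulg1|lia].
  rewrite /Y (@cls_half d p) ?eqxx ?orbT //; last by lia.
  by apply: (mulgI v0); rewrite E.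
rewrite -(mul1g x1) prM pr_1 -v1E mul1g => /orP[] /eqP E; last first.
  by rewrite /Y cls_loop ?mulg1 ?eqxx ?orbT //; [apply: (mulgI v1); rewrite E mulg1|lia].
rewrite /Y -clsM cls_loop ?eqxx // ?size_cat; last by lia.
by apply: (mulgI v0); rewrite wval_cat mulgA -v1E E mulg1.
Qed.

Definition dcol v (x : H) : bool := ~~ Y x && `[< R v (pr x) >].

(* On a short closed walk meeting [Y] the cocycle [theta] is the coboundary of [dcol]. *)
Lemma par_short x c i j : wval c = 1 -> (size c <= r)%N -> (i <= size c)%N ->
  Y (x * cls (take i c)) -> (j <= size c)%N ->
  par x (take j c) = dcol (pr (x * cls (take i c))) x (+)
    dcol (pr (x * cls (take i c))) (x * cls (take j c)).
Proof.
move=> c1 cr ic Yi; set v := pr _; have vY : v \in [:: v0; v1] by apply: pr_Y.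
have cw : cwalk_through e r v (pr x :: vpath (pr x) c).
  exists (pr x), (vpath (pr x) c); split=> //; split; first exact: path_vpath.
  split; first by rewrite last_vpath c1 mulg1.
  by rewrite size_vpath; split=> //; rewrite /v prM; apply: vpath_take_mem.
have bv k : ball_vertex e r v (pr (x * cls (take k c))).
  by exists (pr x :: vpath (pr x) c); split=> //; rewrite prM; apply: vpath_take_mem.
elim: j => [|j IH] jc; first by rewrite take0 (cls_nil clsM) mulg1 addbb.
have jc' := ltnW jc; have [s0 _] : exists s0 : letter S, True by case: (c) jc => // s; exists s.
pose s := nth s0 c j; have tj : take j.+1 c = take j c ++ [:: s] by rewrite (take_nth s0) // cats1.
rewrite tj par_cat IH //= addbF clsM mulgA -addbA; congr (_ (+) _).
have tS : x * cls (take j c) * cls [:: s] = x * cls (take j.+1 c) by rewrite tj clsM mulgA.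
pose z := x * cls (take j c); pose z' := x * cls (take j.+1 c).
rewrite /sg tS -/z -/z'.
have prz' : pr z' = pr z * val s by rewrite /z' -tS prM /= mulg1.
have edge : e (pr z) (pr z') by rewrite prz' /e /cayley mulKg (valP s).
have be : ball_edge e r v (pr z) (pr z').
  exists (pr x :: vpath (pr x) c); split=> //; left.
  have cE : take j c ++ s :: drop j.+1 c = c by rewrite -drop_nth // cat_take_drop.
  by rewrite prz' /z prM /=; have := vpath_edge (pr x) (take j c) s (drop j.+1 c); rewrite cE.
have nY k : (k <= size c)%N -> ~~ Y (x * cls (take k c)) ->
    pr (x * cls (take k c)) \notin [:: v0; v1].
  by move=> kc; apply: contra; apply: Y_pr Yi.
have b1 := bv j; have b2 := bv j.+1; have n1 := nY j jc'; have n2 := nY j.+1 jc.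
rewrite -/z in b1 n1; rewrite -/z' in b2 n2.
(* An edge inside [Y] contributes nothing; an edge between [Y] and its outside projects to one at
   the separator, where [R_col] applies; an edge outside [Y] is handled by [R_edge]. *)
rewrite /theta /dcol; case: (boolP (Y z)) => Yz; case: (boolP (Y z')) => Yz' //=.
- have adj : e v0 (pr z') || e v1 (pr z').
    by have := pr_Y Yz; rewrite !inE => /orP[] /eqP <-; rewrite edge ?orbT.
  by apply/asboolP/asboolP => /(R_col vY b2 (n2 Yz') adj).
- have adj : e v0 (pr z) || e v1 (pr z).
    have edge' : e (pr z') (pr z) by rewrite /e (cayley_sym SV).
    by have := pr_Y Yz'; rewrite !inE => /orP[] /eqP <-; rewrite edge' ?orbT.
  suff -> : `[< R v (pr z) >] = `[< col (pr z) >] by rewrite addbb.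
  by apply/asboolP/asboolP => /(R_col vY b1 (n1 Yz) adj).
- have iff := R_edge vY be (n1 Yz) (n2 Yz').
  suff -> : `[< R v (pr z) >] = `[< R v (pr z') >] by rewrite addbF.
  by apply/asboolP/asboolP => /iff.
Qed.

(** A coboundary sums to zero around a closed walk meeting [Y]; on a walk avoiding [Y] every term
    vanishes. *)
Lemma par_loop x c : wval c = 1 -> (size c <= r)%N -> par x c = false.
Proof.
move=> c1 cr; case: (pselect (exists2 i, (i <= size c)%N & Y (x * cls (take i c)))).
  case=> i ic Yi; have := par_short c1 cr ic Yi (leqnn _).
  by rewrite take_size (cls_loop c1 cr) mulg1 addbb.
move=> no; have {}no i : (i <= size c)%N -> ~~ Y (x * cls (take i c)).
  by move=> ic; apply/negP => Yi; apply: no; exists i.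
clear c1 cr; elim: c x no => [|s c IH] x no //=.
have /= := no 0 isT; rewrite (cls_nil clsM) mulg1 => nx.
have /= := no 1%N isT; rewrite take0 => ns.
rewrite /theta (negbTE nx) (negbTE ns) IH // => i ic.
by have := no i.+1 ic; rewrite /= -cat1s clsM mulgA.
Qed.

Lemma par_wequiv w w' : wequiv r w w' -> par 1 w = par 1 w'.
Proof.
elim=> {w w'} [_ _ [q [c [q' [-> -> c1 cr]]]]|w|w w' _ ->|w w' w'' _ -> _ ->] //.
by rewrite !par_cat (par_loop _ c1 cr) (cls_loop c1 cr) mulg1.
Qed.

(** A potential of [theta], independent of the chosen word because [par] vanishes on every
    relator. *)
Definition height2 (x : H) : bool := par 1 (sval (cid (cls_surj x))).

Lemma height2_cls w : height2 (cls w) = par 1 w.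
Proof. by rewrite /height2; case: cid => w' /= /clsE /par_wequiv. Qed.

Lemma height2M x w : height2 (x * cls w) = height2 x (+) par x w.
Proof. by have [w' ->] := cls_surj x; rewrite -clsM !height2_cls par_cat mul1g. Qed.

(** The path [p] followed by its inverse is a closed walk of length at most [r], so along [p] the
    cocycle is the coboundary of a function vanishing on [Y]. *)
Lemma height2_Y x : Y x -> height2 x = false.
Proof.
case/orP=> /eqP ->; first by rewrite -(cls_nil clsM) height2_cls.
rewrite height2_cls; pose c := p ++ winv SV p.
have c1 : wval c = 1 by rewrite wval_cat wval_winv mulgV.
have cr : (size c <= r)%N by rewrite size_cat size_winv.
have Y0 : Y (1 * cls (take 0 c)) by rewrite take0 (cls_nil clsM) mul1g /Y eqxx.
have := @par_short 1 c 0 (size p) c1 cr isT Y0.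
rewrite /c take_size_cat // size_cat leq_addr => ->//.
have dY v z : Y z -> dcol v z = false by rewrite /dcol => ->.
by rewrite !dY // ?mul1g /Y eqxx ?orbT.
Qed.

(** The closed walk through [v] and [x] is lifted so that [v] lands in [Y], where the height is
    zero; [par_short] then gives the height over [x]. *)
Lemma ball_lift v x : v \in [:: v0; v1] -> ball_vertex e r v x -> x \notin [:: v0; v1] ->
  exists z, [/\ ~~ Y z, pr z = x & height2 z = `[< R v x >]].
Proof.
move=> vY [_ [[x' [t [-> [pt [lt [st vt]]]]]] xt]] xY.
have [c tE] := path_word pt; subst t; rewrite last_vpath in lt; rewrite size_vpath in st.
have c1 : wval c = 1 by apply: (mulgI x'); rewrite lt mulg1.
have [i ic vi] := mem_vpath vt; have [j jc xj] := mem_vpath xt.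
have [y Yy py] : exists2 y, Y y & pr y = v.
  move: vY; rewrite !inE => /orP[] /eqP ->; first by exists 1; rewrite ?pr_1 // /Y eqxx.
  exists x1; first by rewrite /Y eqxx orbT.
  by rewrite -(mul1g x1) prM pr_1.
pose X := y * (cls (take i c))^-1.
have yX : X * cls (take i c) = y by rewrite /X mulgVK.
have pX : pr X = x'.
  by apply: (mulIg (wval (take i c))); rewrite -prM yX py vi.
have Yi : Y (X * cls (take i c)) by rewrite yX.
have h0 := par_short c1 st ic Yi ic; have hj := par_short c1 st ic Yi jc.
exists (X * cls (take j c)).
have pz : pr (X * cls (take j c)) = x by rewrite prM pX.
have nY : ~~ Y (X * cls (take j c)) by apply: contra xY => /pr_Y; rewrite pz.
have dy : dcol v y = false by rewrite /dcol Yy.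
split=> //; rewrite height2M hj yX py.
have := height2_Y Yi; rewrite height2M h0 yX py dy addbF => E.
by rewrite addbA E /dcol nY pz.
Qed.

(** Edges avoiding [Y] do not change [height2], so the vertices of odd height outside [Y] form a
    side. *)
Lemma local_cut : (exists v x, [/\ v \in [:: v0; v1], ball_vertex e r v x, x \notin [:: v0; v1] & R v x]) ->
  (exists v x, [/\ v \in [:: v0; v1], ball_vertex e r v x, x \notin [:: v0; v1] & ~ R v x]) ->
  exists A y0 y1, cut (cgen cls) A y0 y1.
Proof.
move=> [v [x [vY bx xY Rx]]] [v' [x' [vY' bx' xY' Rx']]].
have [z [nz _ hz]] := ball_lift vY bx xY; have [z' [nz' _ hz']] := ball_lift vY' bx' xY'.
exists (fun x => ~~ Y x && height2 x), 1, x1; split.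
- by exists z; rewrite nz hz; apply/asboolP.
- by rewrite /Y eqxx.
- by rewrite /Y eqxx orbT.
- move=> y _ /andP[nY hy] [s ->]; case: (boolP (Y (y * cls [:: s]))) => [|nYs].
    by case/orP=> /eqP; auto.
  by left; rewrite height2M hy /= /theta (negbTE nY) (negbTE nYs).
- exists z'; move: nz'; rewrite /Y negb_or => /andP[/eqP a /eqP b]; split=> //.
  by rewrite hz'; case/andP=> _ /asboolP.
Qed.
End LocalCut.

Lemma ball_edge_vertex (T : finType) (e : rel T) r v x y :
  ball_edge e r v x y -> ball_vertex e r v x /\ ball_vertex e r v y.
Proof.
have mem_zip (s t : seq T) a b : (a, b) \in zip s t -> a \in s /\ b \in t.
  elim: s t => [|z s IH] [|z' t] //=; rewrite !inE => /orP[/eqP[-> ->]|/IH[-> ->]];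
    by rewrite ?eqxx ?orbT.
by case=> s [cs [] /mem_zip[xs /mem_behead ys]]; split; exists s.
Qed.

Lemma local_sep_cut (gT : finGroupType) (S : {set gT}) (r : nat) (H : groupType)
    (cls : seq (letter S) -> H) :
  (forall x, x \in S -> x^-1 \in S) -> (1 < r)%N ->
  (forall x, exists w, x = cls w) -> (forall w w', cls (w ++ w') = cls w * cls w') ->
  (forall w w', cls w = cls w' <-> wequiv r w w') ->
  has_local_sep_le2 (cayley S) r -> exists A y0 y1, cut (cgen cls) A y0 y1.
Proof.
move=> SV r2 surj clsM clsE.
have eb (v x y : gT) : ball_edge (cayley S) r v x y -> ball_edge (cayley S) r v y x.
  by case=> s [cs h]; exists s; split=> //; tauto.
have notin2 (v0 v1 x : gT) : x \notin [:: v0; v1] -> x != v0 /\ x != v1.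
  by rewrite !inE negb_or => /andP.
case=> [[v [x [y [Vx [Vy nc]]]]]|[v0 [v1 [v01 [[a [b [na [nb nc]]]] [q [pq [lq sq]]]]]]]].
- pose C g := conn (ballX_vertex (cayley S) r v [:: v]) (ballX_edge (cayley S) r v [:: v]) x g.
  have Cstep g h : ball_edge (cayley S) r v g h -> g \notin [:: v] -> h \notin [:: v] -> C g -> C h.
    move=> be gv hv Cg; apply: (conn_step Cg) => //.
    by split=> //; case: (ball_edge_vertex be).
  have vv (g : gT) : (g \notin [:: v; v]) = (g \notin [:: v]) by rewrite !inE orbb.
  (* Both [col] and [R] are the component of [x] in the punctured ball. *)
  apply: (@local_cut _ _ r SV r2 _ _ surj clsM clsE v v [::] _ _ C (fun _ => C)).
  + by rewrite mulg1.
  + by [].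
  + move=> v' g h v'Y; have {v'Y}-> : v' = v by move: v'Y; rewrite !inE orbb => /eqP.
    move=> be; rewrite !vv => gv hv; split; apply: Cstep => //.
    exact: eb.
  + by [].
  + exists v, x; rewrite inE eqxx vv; case: (Vx) => bx xv; split=> //; exact: conn_refl.
  + by exists v, y; rewrite inE eqxx vv; case: (Vy) => by_ yv; split.
- have [w qE] := path_word pq; subst q; rewrite last_vpath in lq; rewrite size_vpath in sq.
  pose V g := ballX_vertex (cayley S) r g [:: v0; v1].
  pose E g := ballX_edge (cayley S) r g [:: v0; v1].
  pose col g := conn (nbhd2 (cayley S) v0 v1) (Cr_adj (cayley S) r v0 v1) a g.
  (* [R v] spreads the colour from coloured neighbours through the punctured ball at [v]; by
     definition of [Cr_adj] it reaches no neighbour of another colour. *)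
  pose R v g := exists a', [/\ nbhd2 (cayley S) v0 v1 a', col a' & conn (V v) (E v) a' g].
  have Rstep v g h : ball_edge (cayley S) r v g h -> g \notin [:: v0; v1] -> h \notin [:: v0; v1] ->
      R v g -> R v h.
    move=> be gv hv [a' [n' c' cc]]; exists a'; split=> //; apply: (conn_step cc) => //.
    by split=> //; case: (ball_edge_vertex be).
  have Rcol v x : v \in [:: v0; v1] -> nbhd2 (cayley S) v0 v1 x -> R v x -> col x.
    move=> vY nx [a' [n' c' cc]]; apply: (conn_step c') => //; by exists v.
  have nbr x : nbhd2 (cayley S) v0 v1 x -> exists v, [/\ v \in [:: v0; v1],
      ball_vertex (cayley S) r v x & x \notin [:: v0; v1]].
    move=> [x0 [x1 adj]].
    have [v vY vx] : exists2 v, v \in [:: v0; v1] & cayley S v x.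
      by case/orP: adj => h; [exists v0|exists v1]; rewrite // !inE eqxx ?orbT.
    exists v; split=> //; last by rewrite !inE negb_or x0.
    exists [:: v; x; v]; split; last by rewrite !inE eqxx orbT.
    by exists v, [:: x; v]; rewrite /= vx (cayley_sym SV) vx inE eqxx.
  apply: (@local_cut _ _ r SV r2 _ _ surj clsM clsE v0 v1 w _ _ col R).
  + by rewrite lq.
  + by rewrite addnn.
  + move=> v g h vY be gv hv; split; apply: Rstep => //; exact: eb.
  + move=> v x vY bx xY adj; have nx : nbhd2 (cayley S) v0 v1 x.
      by have [x0 x1] := notin2 _ _ _ xY.
    split=> [/Rcol|cx]; first by apply.
    by exists x; split=> //; apply: conn_refl.
  + have [v [vY bv xY]] := nbr _ na; exists v, a; split=> //.
    by exists a; split=> //; apply: conn_refl.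
  + have [v [vY bv xY]] := nbr _ nb; exists v, b; split=> //.
    by move/(Rcol _ _ vY nb).
Qed.

(** * The covering graph as a Cayley graph *)

Section CoverWalks.
Variables (gT : finGroupType) (S : {set gT}) (r : nat).
Hypothesis SV : forall x, x \in S -> x^-1 \in S.
Hypothesis r2 : (1 < r)%N.
Let e := cayley S.

Definition walkof (w : seq (letter S)) : seq gT := 1 :: vpath 1 w.

Lemma vpath_inj v : injective (@vpath gT S v).
Proof.
move=> w w'; elim: w w' v => [|s w IH] [|s' w'] v //= [/mulgI /val_inj -> /IH ->] //.
Qed.

Lemma walkof_inj : injective walkof.
Proof. by move=> w w' [] /vpath_inj. Qed.

Lemma valid_walkP s : valid_walk e 1 s <-> exists w, s = walkof w.
Proof.
split=> [[t [-> /path_word [w ->]]]|[w ->]]; first by exists w.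
by exists (vpath 1 w); split=> //; exact: path_vpath.
Qed.

Lemma last_walkof w : last 1 (walkof w) = wval w.
Proof. by rewrite /= last_vpath mul1g. Qed.

Lemma walkof_cat w w' : walkof (w ++ w') = walkof w ++ vpath (wval w) w'.
Proof. by rewrite /walkof vpath_cat mul1g. Qed.

Lemma vpath_split (v : gT) (w : seq (letter S)) t t' : vpath v w = t ++ t' ->
  exists w1 w2, [/\ w = w1 ++ w2, t = vpath v w1 & t' = vpath (v * wval w1) w2].
Proof.
elim: t v w => [|x t IH] v w /=; first by move=> <-; exists [::], w; rewrite mulg1.
case: w => [|s w] //= [<- /IH [w1 [w2 [-> -> ->]]]].
by exists (s :: w1), w2; rewrite /= mulgA.
Qed.

Lemma walkof_split w t a t' : walkof w = t ++ a :: t' ->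
  exists w1 w2, [/\ w = w1 ++ w2, rcons t a = walkof w1, a = wval w1 & t' = vpath a w2].
Proof.
case: t => [|x t] /= [].
  by move=> <- <-; exists [::], w.
move=> <-; rewrite -cat_rcons => /vpath_split [w1 [w2 [-> E ->]]].
exists w1, w2; have aE : a = wval w1 by rewrite -(mul1g (wval w1)) -last_vpath -E last_rcons.
by rewrite /walkof -E mul1g -aE.
Qed.

(** [cover_move] acts on arbitrary sequences, not only on walks from [1]. Both directions are
    recorded so that validity and the class of the word survive the symmetric closure. *)
Definition related (s t : seq gT) :=
  (forall w, s = walkof w -> exists2 w', t = walkof w' & wequiv r w w') /\
  (forall w', t = walkof w' -> exists2 w, s = walkof w & wequiv r w w').

Lemma related_closed p a c q : path e a c -> last a c = a -> (size c <= r)%N ->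
  related (p ++ a :: q) (p ++ a :: (c ++ q)).
Proof.
move=> pc lc sc; have [cw cE] := path_word pc.
have cw1 : wval cw = 1 by apply: (mulgI a); rewrite -last_vpath -cE lc mulg1.
have cws : (size cw <= r)%N by rewrite -(size_vpath a) -cE.
have step w1 w2 : wequiv r (w1 ++ w2) (w1 ++ cw ++ w2) by apply: rst_step; exists w1, cw, w2.
split=> w /esym E.
  have [w1 [w2 [wE pE aE qE]]] := walkof_split E.
  exists (w1 ++ cw ++ w2); last by rewrite wE.
  by rewrite walkof_cat -pE vpath_cat cw1 mulg1 -aE -cE -qE cat_rcons.
have [w1 [w2 [wE pE aE /esym /vpath_split [w3 [w4 [w2E cE' qE]]]]]] := walkof_split E.
have w3E : w3 = cw by apply: (@vpath_inj a); rewrite -cE -cE'.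
exists (w1 ++ w4); last by rewrite wE w2E w3E.
by rewrite walkof_cat -pE -aE cat_rcons qE w3E cw1 mulg1.
Qed.

Lemma related_move s t : cover_move e r s t -> related s t.
Proof.
case=> [p a b q ab|p a c q]; last exact: related_closed.
have ba : e b a by rewrite /e (cayley_sym SV).
by apply: (@related_closed p a [:: b; a]); rewrite /= ?ab ?ba.
Qed.

Lemma related_equiv s t : cover_equiv e r s t -> related s t.
Proof.
elim=> {s t} [s t /related_move //|s|s t _ [h1 h2]|s t u _ [h1 h2] _ [k1 k2]].
- by split=> w E; exists w => //; exact: rst_refl.
- split=> w E.
    by have [w' -> h] := h2 w E; exists w' => //; exact: rst_sym.
  by have [w' -> h] := h1 w E; exists w' => //; exact: rst_sym.
- split=> w E.
    have [w' E' h] := h1 w E; have [w'' -> h'] := k1 _ E'.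
    by exists w'' => //; exact: rst_trans h h'.
  have [w' E' h] := k2 w E; have [w'' -> h'] := h2 _ E'.
  by exists w'' => //; exact: rst_trans h' h.
Qed.

Lemma cover_equivP w w' : cover_equiv e r (walkof w) (walkof w') <-> wequiv r w w'.
Proof.
split=> [/related_equiv [h _]|].
  by have [w'' /walkof_inj ->] := h w erefl.
elim=> {w w'} [_ _ [p [c [q [-> -> c1 cr]]]]|w|w w' _|w w' w'' _ h1 _ h2].
- apply: rst_step; rewrite !walkof_cat vpath_cat c1 mulg1.
  rewrite /walkof lastI last_vpath mul1g !cat_rcons; apply: mv_closed; [exact: path_vpath| |by rewrite size_vpath].
  by rewrite last_vpath c1 mulg1.
- exact: rst_refl.
- exact: rst_sym.
- exact: rst_trans h1 h2.
Qed.

Variables (H : groupType) (cls : seq (letter S) -> H).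
Hypothesis cls_surj : forall x, exists w, x = cls w.
Hypothesis clsM : forall w w', cls (w ++ w') = cls w * cls w'.
Hypothesis clsE : forall w w', cls w = cls w' <-> wequiv r w w'.

Lemma walkof_equivP w w' : cover_equiv e r (walkof w) (walkof w') <-> cls w = cls w'.
Proof. by rewrite cover_equivP clsE. Qed.

Lemma rcons_walkof w s : rcons (walkof w) (wval w * val s) = walkof (rcons w s).
Proof. by rewrite -!cats1 walkof_cat. Qed.

Lemma cover_adj1P w w' :
  cover_adj1 e 1 r (walkof w) (walkof w') <-> exists s, cls w' = cls w * cls [:: s].
Proof.
split=> [[x [ex h]]|[s E]].
  rewrite last_walkof in ex; pose s : letter S := Sub ((wval w)^-1 * x) ex.
  exists s; rewrite -clsM cats1; apply/walkof_equivP.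
  by rewrite -rcons_walkof /= mulKVg.
exists (wval w * val s); rewrite last_walkof /e /cayley mulKg (valP s); split=> //.
by rewrite rcons_walkof; apply/walkof_equivP; rewrite -cats1 clsM.
Qed.

Lemma cover_edgeP w w' :
  cover_edge e 1 r (walkof w) (walkof w') <-> exists s, cls w' = cls w * cls [:: s].
Proof.
split=> [|h]; last by left; apply/cover_adj1P.
case=> /cover_adj1P // [s E]; exists (linv SV s).
by rewrite E (_ : [:: linv SV s] = winv SV [:: s]) // (clsV SV r2 clsM clsE) mulgK.
Qed.

(** A walk of length [#|gT|] repeats a vertex, and the closed piece in between has length at most
    [r], so it can be deleted. *)
Lemma short_rep w : (#|gT| <= r)%N -> exists2 w', (size w' < #|gT|)%N & cls w = cls w'.
Proof.
move=> gr; have [m] := ubnP (size w); elim: m w => // m IH w; rewrite ltnS => wm.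
case: (ltnP (size w) #|gT|) => [?|gw]; first by exists w.
pose w1 := take #|gT| w; have sw1 : size w1 = #|gT| by rewrite size_takel.
have : ~~ uniq (walkof w1).
  apply/negP => /card_uniqP; rewrite /= size_vpath sw1 => E.
  by have := max_card (mem (walkof w1)); rewrite E ltnn.
case/(uniqPn 1)=> i [j [ij]]; rewrite /= size_vpath sw1 ltnS => jg.
have nthE k : (k <= #|gT|)%N -> nth 1 (walkof w1) k = wval (take k w).
  move=> kg; have -> : w1 = take k w ++ drop k w1.
    by rewrite -{1}(cat_take_drop k w1) /w1 take_takel.
  rewrite walkof_cat nth_cat /= size_vpath size_takel; last by lia.
  rewrite ltnSn -[X in nth _ _ X](_ : (size (walkof (take k w))).-1 = k).
    by rewrite nth_last last_walkof.
  by rewrite /= size_vpath size_takel //; lia.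
rewrite !nthE //; last by lia.
pose c := take (j - i) (drop i w) => E.
have tj : take j w = take i w ++ c.
  by rewrite /c -{1}(cat_take_drop i (take j w)) take_takel ?take_drop ?subnK //; lia.
have c1 : wval c = 1 by apply: (mulgI (wval (take i w))); rewrite mulg1 -wval_cat -tj -E.
have sc : size c = (j - i)%N by rewrite size_takel // size_drop; lia.
have cc : cls c = 1 by apply: (cls_short clsM clsE) => //; lia.
have [|w' sw' E'] := IH (take i w ++ drop j w).
  by rewrite size_cat size_takel ?size_drop; lia.
exists w' => //; rewrite -E' clsM -{1}(cat_take_drop j w) clsM tj clsM cc mulg1 //.
Qed.

Lemma two_ends_big : two_ends_sep_le2 e 1 r -> (r < #|[set: gT]|)%N.
Proof.
case=> f [_ [[vf [_ inj]] _]]; rewrite cardsT ltnNge; apply/negP => gr.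
have [w wE] : {w : nat -> seq (letter S) & forall i, f i = walkof (w i)}.
  by apply: (@choice _ _ (fun i w => f i = walkof w)) => i; apply/valid_walkP.
have [w' wE'] : {w' : nat -> seq (letter S) & forall i, (size (w' i) < #|gT|)%N /\ cls (w i) = cls (w' i)}.
  apply: (@choice _ _ (fun i w' => (size w' < #|gT|)%N /\ cls (w i) = cls w')) => i.
  by have [v sv E] := short_rep (w i) gr; exists v.
have inj' i j : w' i = w' j -> i = j.
  move=> E; apply: inj; rewrite !wE; apply/walkof_equivP.
  by rewrite (wE' i).2 (wE' j).2 E.
(* Words shorter than [#|gT|] are padded with [None] to functions on a finite type; this bounds
   their number and contradicts an infinite ray. *)
pose code (v : seq (letter S)) : {ffun 'I_#|gT| -> option (letter S)} :=
  [ffun k : 'I_#|gT| => nth None (map Some v) k].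
have code_inj v v' : (size v < #|gT|)%N -> (size v' < #|gT|)%N -> code v = code v' -> v = v'.
  move=> sv sv' /ffunP E.
  have E' k : (k < #|gT|)%N -> nth None (map Some v) k = nth None (map Some v') k.
    by move=> kg; have := E (Ordinal kg); rewrite !ffunE.
  have sz : size v = size v'.
    apply/eqP; rewrite eqn_leq; apply/andP; split; rewrite leqNgt; apply/negP => lt.
      have := E' _ sv'; rewrite [RHS]nth_default ?size_map //.
      by case: (v) lt => // s v1 lt; rewrite (nth_map s).
    have := E' _ sv; rewrite [LHS]nth_default ?size_map //.
    by case: (v') lt => // s v1 lt; rewrite (nth_map s).
  case: v sz sv E' {E} => [|s v]; first by case: v' {sv'}.
  move=> sz sv E'; apply: (@eq_from_nth _ s) => // k kv.
  have := E' k (ltn_trans kv sv); rewrite !(nth_map s) -?sz //; by case.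
pose m := #|{: {ffun 'I_#|gT| -> option (letter S)}}|.
have /leq_card : injective (fun i : 'I_m.+1 => code (w' i)).
  by move=> i j E; apply/val_inj/inj'/code_inj => //; [exact: (wE' i).1|exact: (wE' j).1].
by rewrite card_ord ltnn.
Qed.

Lemma conn_target (T : Type) (V : T -> Prop) (E : T -> T -> Prop) x y : conn V E x y -> V y.
Proof. by case. Qed.

Lemma conn_last (T : Type) (V : T -> Prop) (E : T -> T -> Prop) x y :
  conn V E x y -> x = y \/ exists2 z, conn V E x z & E z y.
Proof. by case=> [z|z t v cz tv Vv]; [left|right; exists t]. Qed.

Lemma two_ends_cut : two_ends_sep_le2 e 1 r -> exists A y0 y1, cut (cgen cls) A y0 y1.
Proof.
case=> f [g [[vf [ef _]] [[vg _] [_ [Y [sY [vY [M [av nc]]]]]]]]].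
pose V := cover_avoid e 1 r Y; pose E := cover_edge e 1 r.
pose A x := exists2 w, cls w = x & conn V E (f M) (walkof w).
have [wf fE] := (valid_walkP _).1 (vf M); have [wg gE] := (valid_walkP _).1 (vg M).
have Af : A (cls wf) by exists wf => //; rewrite -fE; apply: conn_refl; case: (av M (leqnn _)).
have edge_to s w w' : valid_walk e 1 s -> cls w = cls w' -> E s (walkof w) -> E s (walkof w').
  by move=> /valid_walkP [v ->] ww /cover_edgeP [t]; rewrite ww => h; apply/cover_edgeP; exists t.
(* [conn] speaks of representatives: a path ending in a walk equivalent to [g M] is rerouted at its
   last edge, after a detour through [f M.+1] if it has length zero. *)
have nAg : ~ A (cls wg).
  case=> w ww cw; apply: nc; have [_ Vg] := av M (leqnn _).
  have [Vf1 _] := av M.+1 (leqnSn _).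
  have [Vf _] := av M (leqnn _).
  rewrite gE in Vg *; case: (conn_last cw) => [Ef|[y cy yw]].
    apply: (@conn_step _ _ _ _ (f M.+1)) => //.
      by apply: (@conn_step _ _ _ _ (f M)) => //; exact: conn_refl.
    apply: (@edge_to _ w) => //; rewrite -Ef; case: (ef M); [by right|by left].
  apply: (conn_step cy) => //; apply: (@edge_to _ w) => //.
  by case: (conn_target cy).
have step x s : A x -> cgen cls s -> A (x * s) \/ exists2 v, walkof v \in Y & x * s = cls v.
  move=> [w <- cw] [t ->]; rewrite -clsM.
  case: (pselect (exists2 y, y \in Y & cover_equiv e r (walkof (w ++ [:: t])) y)) => [[y yY yE]|no].
    right; have [v yv] := (valid_walkP _).1 (vY y yY); exists v; first by rewrite -yv.
    by apply/walkof_equivP; rewrite -yv.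
  left; exists (w ++ [:: t]) => //; apply: (conn_step cw); first by apply/cover_edgeP; exists t; rewrite clsM.
  by split=> [|y yY yE]; [apply/valid_walkP; eexists|apply: no; exists y].
have nAY v : walkof v \in Y -> ~ A (cls v).
  move=> vy [w ww cw]; have [_ h] : cover_avoid e 1 r Y (walkof w) := conn_target cw.
  apply: (h _ vy); exact/walkof_equivP.
have nYg v : walkof v \in Y -> cls wg <> cls v.
  move=> vy E'; have [_ [_ h]] := av M (leqnn _); apply: (h _ vy).
  by rewrite gE; apply/walkof_equivP.
have fromY y : y \in Y -> exists2 v, y = walkof v & walkof v \in Y.
  by move=> yY; have [v yv] := (valid_walkP _).1 (vY y yY); exists v; rewrite -?yv.
have build v0 v1 : walkof v0 \in Y -> walkof v1 \in Y ->
    (forall v, walkof v \in Y -> v = v0 \/ v = v1) -> cut (cgen cls) A (cls v0) (cls v1).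
  move=> Y0 Y1 all; split; [by exists (cls wf)|exact: nAY|exact: nAY| |].
    move=> x s Ax Ss; case: (step x s Ax Ss) => [|[v vy ->]]; first by left.
    by right; case: (all v vy) => ->; auto.
  by exists (cls wg); split=> //; exact: nYg.
clearbody A; clear nc av vY nAY nYg V.
case: Y sY fromY step build => [|y [|y' [|? ?]]] // _ fromY step build.
- case: nAg; apply: (closed_full (cgen_ind cls_surj clsM) Af) => x s Ax Ss.
  by case: (step x s Ax Ss) => // -[].
- have [v yv vY] := fromY y (mem_head _ _); exists A, (cls v), (cls v); apply: build => // v'.
  by rewrite inE yv => /eqP /walkof_inj; left.
- have [v yv vY] := fromY y (mem_head _ _).
  have [v' yv' vY'] : exists2 v, y' = walkof v & walkof v \in [:: y; y'].
    by apply: fromY; rewrite !inE eqxx orbT.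
  exists A, (cls v), (cls v'); apply: build => // v''.
  by rewrite !inE yv yv' => /orP[] /eqP /walkof_inj; auto.
Qed.
End CoverWalks.

(** * Cyclic groups and their products with [C_2] *)

Section CyclicTimesLe2.
Variables (gT : finGroupType) (r : nat) (a b : gT).
Hypothesis r20 : (20 <= r)%N.
Hypothesis oa : (r < #[a])%N.
Hypothesis ab : commute a b.
Hypothesis bb : b * b = 1.
Hypothesis ab_TI : <[a]> :&: <[b]> = 1.
Hypothesis ab_gen : <[a]> * <[b]> = [set: gT].

(** Removing [1] lets [b = 1] stand for the cyclic case. *)
Definition abset : {set gT} := [set a; a^-1] :|: ([set b] :\ 1).
Let S := abset.
Let r2 : (1 < r)%N. Proof. by apply: leq_trans r20. Qed.

Lemma a_neq1 : a != 1.
Proof. by apply/eqP => E; move: oa; rewrite E order1; lia. Qed.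

Lemma a_neqV : a != a^-1.
Proof.
apply/eqP => E; have : a ^+ 2 = 1 by rewrite expgS expg1 {2}E mulgV.
by move/eqP; rewrite -order_dvdn => /dvdn_leq; lia.
Qed.

Lemma bV : b^-1 = b.
Proof. exact: mulg1_eq. Qed.

Lemma b_notin k : b <> 1 -> b <> a ^+ k.
Proof.
move=> b1 E; apply: b1; apply/set1gP; rewrite -ab_TI inE cycle_id andbT E.
exact: groupX (cycle_id a).
Qed.

Lemma aS : a \in S. Proof. by rewrite !inE eqxx. Qed.
Lemma aVS : a^-1 \in S. Proof. by rewrite !inE eqxx orbT. Qed.

Lemma abset_inv x : x \in S -> x^-1 \in S.
Proof.
rewrite !inE => /orP[/orP[] /eqP ->|/andP[x1 /eqP E]]; rewrite ?invgK ?eqxx ?orbT //.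
by move: x1; rewrite E bV eqxx => ->; rewrite orbT.
Qed.

Lemma abset_generating : generating_set S.
Proof.
split; first by rewrite !inE eqxx /= orbF eq_sym (negbTE a_neq1) /= eq_sym invg_eq1 (negbTE a_neq1).
split; first exact: abset_inv.
apply/eqP; rewrite eqEsubset subsetT -ab_gen mulG_subG !cycle_subG mem_gen ?aS //=.
have [->|b1] := eqVneq b 1; first exact: group1.
by rewrite mem_gen // !inE b1 eqxx orbT.
Qed.

Local Notation letterS := (letter S).
Let la : letterS := Sub a aS.
Let lv : letterS := Sub a^-1 aVS.
(** Spells [b] also when [b = 1], which is not a letter: the word is then empty. *)
Let lb : seq letterS := if insub b is Some s then [:: s] else [::].

Lemma wval_lb : wval lb = b.
Proof.
rewrite /lb; case: insubP => [s _ /= ->|]; first by rewrite mulg1.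
by rewrite !inE eqxx andbT => /norP[_ /negbNE /eqP].
Qed.

Lemma letter_cases (s : letterS) : [\/ s = la, s = lv | lb = [:: s] /\ b <> 1].
Proof.
have := valP s; rewrite !inE => /orP[/orP[] /eqP E|/andP[s1 /eqP E]].
- by constructor 1; apply: val_inj.
- by constructor 2; apply: val_inj.
- constructor 3; split; last by move=> b1; rewrite E b1 eqxx in s1.
  by rewrite /lb -E valK.
Qed.

Definition na (w : seq letterS) := count (fun s => val s == a) w.
Definition nv (w : seq letterS) := count (fun s => val s == a^-1) w.
(** The exponent sum of [a], the coordinate along the line or ladder to which the cover unrolls. *)
Definition hgt (w : seq letterS) : int := ((na w)%:Z - (nv w)%:Z)%R.

Lemma na_nv_size w : (na w + nv w <= size w)%N.
Proof.
elim: w => //= s w IH; case: eqP => [->|_]; last by case: eqP => _ /=; lia.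
by rewrite (negbTE a_neqV) /=; lia.
Qed.

Lemma hgt_cat w w' : hgt (w ++ w') = (hgt w + hgt w')%R.
Proof. by rewrite /hgt /na /nv !count_cat; lia. Qed.

Lemma hgt_la : hgt [:: la] = 1%R.
Proof. by rewrite /hgt /na /nv /= eqxx (negbTE a_neqV). Qed.

Lemma hgt_lv : hgt [:: lv] = (- 1)%R.
Proof. by rewrite /hgt /na /nv /= eqxx eq_sym (negbTE a_neqV). Qed.

Lemma count_lb : na lb = 0 /\ nv lb = 0.
Proof.
rewrite /na /nv /lb; case: insubP => // s; rewrite !inE => bS /= ->.
have b1 : b <> 1.
  move=> E; move: bS; rewrite E eqxx orbF eq_sym (negbTE a_neq1) /=.
  by rewrite eq_sym invg_eq1 (negbTE a_neq1).
have := @b_notin 1 b1; have : b <> a^-1.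
  by move=> E; apply: (@b_notin 1 b1); rewrite expg1 -bV E invgK.
by rewrite expg1 => /eqP /negbTE -> /eqP /negbTE ->.
Qed.

Lemma hgt_lb : hgt lb = 0%R.
Proof. by rewrite /hgt; case: count_lb => -> ->. Qed.

Lemma na_cat w w' : na (w ++ w') = (na w + na w')%N.
Proof. exact: count_cat. Qed.

Lemma nv_cat w w' : nv (w ++ w') = (nv w + nv w')%N.
Proof. exact: count_cat. Qed.

Lemma na_la : na [:: la] = 1%N /\ nv [:: la] = 0.
Proof. by rewrite /na /nv /= eqxx (negbTE a_neqV). Qed.

Lemma na_lv : na [:: lv] = 0 /\ nv [:: lv] = 1%N.
Proof. by rewrite /na /nv /= eqxx eq_sym (negbTE a_neqV). Qed.

Lemma letter_hgt s : [\/ hgt [:: s] = 1%R, hgt [:: s] = (-1)%R | hgt [:: s] = 0%R].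
Proof.
case: (letter_cases s) => [->|->|[<- _]];
  [constructor 1; exact: hgt_la|constructor 2; exact: hgt_lv|constructor 3; exact: hgt_lb].
Qed.

(* Stated for any [cls], so that it applies both to [wval] and to the classes in the cover. *)
Lemma normal_form (H : groupType) (cls : seq letterS -> H) w :
  (forall w w', cls (w ++ w') = cls w * cls w') ->
  cls [:: la] * cls [:: lv] = 1 -> commute (cls [:: la]) (cls lb) -> 
  exists k, cls w * cls [:: la] ^+ nv w = cls [:: la] ^+ na w * cls lb ^+ k.
Proof.
move=> clsM lav lab; have cls1 : cls [::] = 1.
  by apply: (mulgI (cls [::])); rewrite -clsM mulg1.
have lvE : cls [:: lv] = (cls [:: la])^-1 by apply/esym/mulg1_eq.
elim: w => [|s w [k IH]]; first by exists 0; rewrite cls1 mulg1.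
have E : s :: w = [:: s] ++ w by []; rewrite E clsM na_cat nv_cat.
case: (letter_cases s) => [->|->|[<- _]].
- have [-> ->] := na_la; exists k.
  by rewrite add1n add0n -mulgA IH expgS mulgA.
- have [-> ->] := na_lv; exists k; rewrite add1n add0n expgSr lvE -mulgA (mulgA (cls w)) IH.
  have -> : cls [:: la] ^+ na w * cls lb ^+ k * cls [:: la] =
            cls [:: la] * (cls [:: la] ^+ na w * cls lb ^+ k).
    by rewrite -mulgA -(commuteX k lab) !mulgA -expgS expgSr.
  by rewrite mulKg.
- have [-> ->] := count_lb; exists k.+1.
  by rewrite !add0n -mulgA IH expgS !mulgA (commuteX _ (commute_sym lab)).
Qed.

Lemma wval_letter s : wval [:: s : letterS] = val s.
Proof. by rewrite /= mulg1. Qed.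

Lemma wval_normal w : exists k, wval w * a ^+ nv w = a ^+ na w * b ^+ k.
Proof.
have := @normal_form gT (@wval gT S) w (@wval_cat gT S).
rewrite !wval_letter wval_lb; apply=> //; exact: mulgV.
Qed.

(** Comparing normal forms modulo [<b>] gives equal powers of [a] whose exponents are at most
    [size w + size w'], hence below [#[a]]; so the exponents agree as integers. *)
Lemma half_height w w' e : wval w = b ^+ e * wval w' -> (size w + size w' <= r)%N ->
  hgt w = hgt w'.
Proof.
move=> E sz; have [k hk] := wval_normal w; have [k' hk'] := wval_normal w'.
have cX m l : commute (a ^+ m) (b ^+ l) by apply: commuteX2.
have L : wval w * a ^+ nv w * a ^+ nv w' = a ^+ (na w + nv w') * b ^+ k.
  by rewrite hk -!mulgA -(cX (nv w') k) mulgA -expgD.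
have R : wval w * a ^+ nv w * a ^+ nv w' = a ^+ (na w' + nv w) * b ^+ (e + k').
  rewrite E -!mulgA -expgD addnC expgD (mulgA (wval w')) hk' -!mulgA -(cX (nv w) k').
  rewrite !mulgA -(cX (na w') e) -(mulgA (a ^+ na w')) -(cX (nv w) e) !expgD.
  by rewrite !mulgA.
have E2 := etrans (esym L) R.
have s1 := na_nv_size w; have s2 := na_nv_size w'.
have : a ^+ (na w + nv w') == a ^+ (na w' + nv w).
  rewrite eq_sym eq_mulVg1; apply/eqP/set1gP; rewrite -ab_TI inE.
  rewrite groupM ?groupV ?groupX ?cycle_id //=.
  have -> : a ^- (na w' + nv w) * a ^+ (na w + nv w') = b ^+ (e + k') * b ^- k.
    by apply: (mulIg (b ^+ k)); rewrite -mulgA E2 mulKg mulgKV.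
  by rewrite groupM ?groupV ?groupX ?cycle_id.
rewrite eq_expg_mod_order !modn_small; [|lia|lia].
by move=> /eqP; rewrite /hgt; lia.
Qed.

Let SV := abset_inv.
Let sepY : seq (seq gT) := [:: walkof (Nil letterS); walkof lb].

(** * Separation at height zero, in the cover and in the group *)

Section AbCover.
Variables (H : groupType) (cls : seq letterS -> H).
Hypothesis cls_surj : forall x, exists w, x = cls w.
Hypothesis clsM : forall w w', cls (w ++ w') = cls w * cls w'.
Hypothesis clsE : forall w w', cls w = cls w' <-> wequiv r w w'.

Lemma hgt_wequiv w w' : wequiv r w w' -> hgt w = hgt w'.
Proof.
elim=> {w w'} [_ _ [p [c [q [-> -> c1 cr]]]]|w|w w' _ ->|w w' w'' _ -> _ ->] //.
have c0 : hgt c = 0%R.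
  by rewrite (@half_height c [::] 0) //= ?c1 ?mulg1 ?addn0.
by rewrite !hgt_cat c0; lia.
Qed.

Lemma hgt_cls w w' : cls w = cls w' -> hgt w = hgt w'.
Proof. by move/clsE/hgt_wequiv. Qed.

Lemma size_lb : (size lb <= 1)%N.
Proof. by rewrite /lb; case: insubP. Qed.

(** The relators for [a * a^-1], for [b * b] and for commutation have length at most four, so normal
    forms hold in the cover: height zero consists of the separator alone. *)
Lemma hgt0_cls w : hgt w = 0%R -> cls w = 1 \/ cls w = cls lb.
Proof.
have sb := size_lb; move=> w0.
have lav : cls [:: la] * cls [:: lv] = 1.
  by rewrite -clsM; apply: (cls_short clsM clsE); rewrite /= ?mulg1 ?mulgV //; lia.
have lab : commute (cls [:: la]) (cls lb).
  rewrite /commute -!clsM; apply: (cls_half SV r2 clsM clsE).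
    by rewrite !wval_cat wval_lb wval_letter; exact: ab.
  by rewrite !size_cat /=; lia.
have lbb : cls lb * cls lb = 1.
  by rewrite -clsM; apply: (cls_short clsM clsE); rewrite ?wval_cat ?wval_lb ?size_cat //; lia.
have [k] := normal_form w clsM lav lab.
have -> : nv w = na w by move: w0; rewrite /hgt; lia.
rewrite (commuteX2 _ _ lab) => /mulIg ->.
have b2 j : cls lb ^+ j.*2 = 1 by elim: j => // j IH; rewrite doubleS !expgS mulgA lbb mul1g.
rewrite -(odd_double_half k) expgnDr b2 mulg1; case: (odd k); [right|left] => //.
Qed.

Lemma avoid_hgt w : cover_avoid (cayley S) 1 r sepY (walkof w) <->
  hgt w <> 0%R.
Proof.
split=> [[_ av] w0|w0].
  case: (hgt0_cls w0) => E.
    apply: (av (walkof (Nil letterS))); first exact: mem_head.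
    by apply/(walkof_equivP SV r2 clsE); rewrite E (cls_nil clsM).
  apply: (av (walkof lb)); first by rewrite !inE eqxx orbT.
  exact/(walkof_equivP SV r2 clsE).
split; first by apply/valid_walkP; exists w.
move=> z; rewrite !inE => /orP[] /eqP -> /(walkof_equivP SV r2 clsE) /hgt_cls E; apply: w0.
  by rewrite E.
by rewrite E hgt_lb.
Qed.

(** Along an edge the height changes by at most one, so it cannot leave the positive range without
    meeting the excluded value zero. *)
Lemma conn_hgt (w : seq letterS) (s : seq gT) : (0 < hgt w)%R ->
  conn (cover_avoid (cayley S) 1 r sepY) (cover_edge (cayley S) 1 r)
    (walkof w) s -> exists2 w', s = walkof w' & (0 < hgt w')%R.
Proof.
move=> w0 c; move: {-2}(walkof w) (erefl (walkof w)) c => t Et c.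
elim: c Et => {t s} [t _ ->|t y z _ IH yz Vz Et]; first by exists w.
have [w' yE w'0] := IH Et; subst y.
have [w'' zE] := (valid_walkP _ _).1 Vz.1; subst z; exists w'' => //.
have [l E] := (cover_edgeP SV r2 clsM clsE w' w'').1 yz.
rewrite -clsM in E; have := hgt_cls E; rewrite hgt_cat.
have := (avoid_hgt w'').1 Vz.
by case: (letter_hgt l) => ->; lia.
Qed.

Lemma hgt_nseq_la k : hgt (nseq k la) = k%:Z%R.
Proof. by elim: k => // k IH; rewrite -[nseq _ _]/([:: la] ++ nseq k la) hgt_cat IH hgt_la; lia. Qed.

Lemma hgt_nseq_lv k : hgt (nseq k lv) = (- k%:Z)%R.
Proof. by elim: k => // k IH; rewrite -[nseq _ _]/([:: lv] ++ nseq k lv) hgt_cat IH hgt_lv; lia. Qed.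

Lemma nseq_ray l : (forall i j, hgt (nseq i l) = hgt (nseq j l) -> i = j) ->
  cover_ray (cayley S) 1 r (fun k => walkof (nseq k l)).
Proof.
move=> inj; split; first by move=> i; apply/valid_walkP; eexists.
split=> [i|i j /(walkof_equivP SV r2 clsE) /hgt_cls /inj //].
by apply/(cover_edgeP SV r2 clsM clsE); exists l; rewrite -clsM -[[:: l]]/(nseq 1 l) -nseqD addn1.
Qed.

Lemma ab_two_ends : two_ends_sep_le2 (cayley S) 1 r.
Proof.
pose f k := walkof (nseq k la); pose g k := walkof (nseq k lv).
have nconn M : (0 < M)%N -> ~ conn (cover_avoid (cayley S) 1 r sepY) (cover_edge (cayley S) 1 r) (f M) (g M).
  move=> M0 /conn_hgt []; first by rewrite hgt_nseq_la; lia.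
  by move=> w /walkof_inj <-; rewrite hgt_nseq_lv; lia.
have av i : (1 <= i)%N -> cover_avoid (cayley S) 1 r sepY (f i) /\ cover_avoid (cayley S) 1 r sepY (g i).
  by move=> i1; split; apply/avoid_hgt; rewrite ?hgt_nseq_la ?hgt_nseq_lv; lia.
exists f, g; split; first by apply: nseq_ray => i j; rewrite !hgt_nseq_la; lia.
split; first by apply: nseq_ray => i j; rewrite !hgt_nseq_lv; lia.
split.
  (* For [M = 0] the first ray starts on the separator, so avoidance already fails. *)
  move=> /(_ sepY) [M [h]]; apply: nconn; case: M h => // /(_ 0 isT) [[_ /(_ (walkof (Nil letterS)))]].
  by rewrite mem_head => /(_ isT) []; exact: rst_refl.
exists sepY; split=> //; split.
  by move=> y; rewrite !inE => /orP[] /eqP ->; apply/valid_walkP; eexists.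
by exists 1%N; split; [exact: av|exact: nconn].
Qed.

(** Height is defined on words, not on the finite group; for words of length at most half of [r]
    starting at [1] or [b], its sign depends only on the endpoint, by [half_height]. *)
Definition above (x : gT) := exists w e,
  [/\ (size w + size w <= r)%N, x = b ^+ e * wval w & (0 < hgt w)%R].

Lemma aboveE e w : (size w + size w <= r)%N -> above (b ^+ e * wval w) <-> (0 < hgt w)%R.
Proof.
move=> sw; split=> [[w' [e' [sw' E h]]]|h]; last by exists w, e.
rewrite (@half_height w w' (e + e')) //; last by lia.
have b2 : b ^+ (e + e) = 1 by rewrite addnn -mul2n expgM expgS expg1 bb expg1n.
by rewrite expgD -mulgA -E mulgA -expgD b2 mul1g.
Qed.

Lemma zip_vpath (v : gT) (c : seq letterS) x y : (x, y) \in zip (v :: vpath v c) (vpath v c) ->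
  exists j, [/\ (j < size c)%N, x = v * wval (take j c) & y = v * wval (take j.+1 c)].
Proof.
elim: c v => [|s c IH] v //=; rewrite inE => /orP[/eqP[-> ->]|/IH [j [jc -> ->]]].
  by exists 0; rewrite /= take0 !mulg1.
by exists j.+1; rewrite /= !mulgA.
Qed.

Lemma b_pow k : b ^+ k = 1 \/ b ^+ k = b.
Proof.
rewrite -(odd_double_half k) expgD -mul2n expgM [b ^+ 2]expgS expg1 bb expg1n mulg1.
by case: (odd k); [right|left]; rewrite ?expg1.
Qed.

Lemma hgt0_wval w : hgt w = 0%R -> exists k, wval w = b ^+ k.
Proof.
move=> w0; have [k E] := wval_normal w; exists k.
have nE : nv w = na w by move: w0; rewrite /hgt; lia.
apply: (mulIg (a ^+ nv w)); rewrite E nE; exact: commuteX2.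
Qed.

(** On a closed walk through [v] both ends of the edge are reached from [v] by words of length at
    most half of [r], with heights differing by at most one. Height zero would make [y] a power of
    [b], which lies in [X]. *)
Lemma ball_edge_above v x y (X : seq gT) : (v = 1 \/ v = b) -> 1 \in X -> b \in X ->
  ball_edge (cayley S) r v x y -> y \notin X -> above x -> above y.
Proof.
move=> vb X1 Xb [_ [[x' [t [-> [pt [lt [st vt]]]]]] xy]] yX ax.
have [c tE] := path_word pt; subst t; rewrite last_vpath in lt; rewrite size_vpath in st.
have c1 : wval c = 1 by apply: (mulgI x'); rewrite lt mulg1.
have [i ic vi] := mem_vpath vt.
have lift j : (j <= size c)%N -> exists d, [/\ x' * wval (take j c) = v * wval d,
    (size d + size d <= r)%N & hgt (take j c) = (hgt (take i c) + hgt d)%R].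
  move=> jc; have [d] := arc SV r2 clsM clsE 1 c1 st ic jc.
  rewrite !mul1g -clsM => dE sd; exists d; split=> //.
    by rewrite vi -mulgA -wval_cat; congr (_ * _); apply/wval_wequiv/clsE/dE.
  by rewrite -hgt_cat; apply: hgt_cls.
have hstep j : (j < size c)%N -> [\/ hgt (take j.+1 c) = (hgt (take j c) + 1)%R,
    hgt (take j.+1 c) = (hgt (take j c) - 1)%R | hgt (take j.+1 c) = hgt (take j c)].
  move=> jc; have [l0 _] : exists l0 : letterS, True by exists la.
  rewrite (take_nth l0) // -cats1 hgt_cat.
  by case: (letter_hgt (nth l0 c j)) => ->; [constructor 1|constructor 2|constructor 3]; lia.
have [k [l [kc lc xE yE kl]]] : exists k l, [/\ (k <= size c)%N, (l <= size c)%N,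
    x = x' * wval (take k c), y = x' * wval (take l c) &
    [\/ hgt (take l c) = (hgt (take k c) + 1)%R,
    hgt (take l c) = (hgt (take k c) - 1)%R | hgt (take l c) = hgt (take k c)]].
  case: xy => /zip_vpath [j [jc E1 E2]]; [exists j, j.+1|exists j.+1, j];
    split=> //; try exact: ltnW; first exact: hstep.
  by case: (hstep j jc) => ->; [constructor 2|constructor 1|constructor 3]; lia.
have [d [dE sd hd]] := lift k kc; have [d' [dE' sd' hd']] := lift l lc.
rewrite dE in xE; rewrite dE' in yE.
have [e vE] : exists e, v = b ^+ e by case: vb => ->; [exists 0|exists 1%N].
rewrite xE vE in ax; move/(aboveE _ sd): ax => ax.
rewrite yE vE; apply/aboveE => //.
have : hgt d' <> 0%R; last by case: kl; lia.
move/hgt0_wval => [m mE]; move: yX; rewrite yE vE mE -expgD.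
by case: (b_pow (e + m)) => ->; rewrite ?X1 ?Xb.
Qed.

Lemma conn_above v x y (X : seq gT) : (v = 1 \/ v = b) -> 1 \in X -> b \in X ->
  conn (ballX_vertex (cayley S) r v X) (ballX_edge (cayley S) r v X) x y -> above x -> above y.
Proof.
move=> vb X1 Xb; elim=> // {x y} x y z _ IH [be [_ zX]] _ /IH.
exact: ball_edge_above be zX.
Qed.

Lemma above_a : above a.
Proof. by exists [:: la], 0; rewrite hgt_la /= mul1g mulg1; split=> //; lia. Qed.

Lemma not_above_aV : ~ above a^-1.
Proof.
have /(aboveE 0) : (size [:: lv] + size [:: lv] <= r)%N by rewrite /=; lia.
by rewrite mul1g wval_letter hgt_lv => -[+ _] => /[apply].
Qed.

Lemma ab_local_sep : has_local_sep_le2 (cayley S) r.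
Proof.
have ball1 x : x \in S -> ball_vertex (cayley S) r 1 x.
  move=> xS; have x1 : cayley S 1 x by rewrite /cayley invg1 mul1g.
  exists [:: 1; x; 1]; split; last by rewrite !inE eqxx orbT.
  by exists 1, [:: x; 1]; rewrite /= x1 (cayley_sym SV) x1 inE eqxx.
have nb x : x = a \/ x = a^-1 -> x != 1 by case=> ->; rewrite ?invg_eq1 a_neq1.
case: (eqVneq b 1) => [b1|b1].
  left; exists 1, a, a^-1.
  split; first by split; [exact/ball1/aS|rewrite inE nb //; left].
  split; first by split; [exact/ball1/aVS|rewrite inE nb //; right].
  move/conn_above; rewrite b1 mem_head => /(_ (or_introl erefl) isT isT above_a).
  exact: not_above_aV.
right; exists 1, b; have na_b x : x = a \/ x = a^-1 -> x != b.
  have bn := b_notin (elimN eqP b1).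
  case=> ->; apply/eqP => E; first by apply: (bn 1%N); rewrite E.
  by apply: (bn 1%N); rewrite -bV -E invgK.
split; first by rewrite eq_sym.
split; last first.
  by exists [:: b]; rewrite /= /cayley invg1 mul1g !inE b1 eqxx !orbT; split=> //; split=> //; lia.
have nbhd x : x = a \/ x = a^-1 -> nbhd2 (cayley S) 1 b x.
  move=> hx; split; first exact: nb.
  split; first exact: na_b.
  by rewrite /cayley invg1 mul1g; case: hx => ->; rewrite ?aS ?aVS.
exists a, a^-1; split; first by apply: nbhd; left.
split; first by apply: nbhd; right.
suff h x y : conn (nbhd2 (cayley S) 1 b) (Cr_adj (cayley S) r 1 b) x y -> above x -> above y.
  by move/h/(_ above_a)/not_above_aV.
elim=> // {x y} x y z _ IH [v vb c] _ /IH; apply: conn_above c; rewrite ?inE ?eqxx ?orbT //.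
by move: vb; rewrite !inE => /orP[] /eqP ->; auto.
Qed.
End AbCover.
End CyclicTimesLe2.

Lemma cyclic_times_le2_gens (gT : finGroupType) (r : nat) : cyclic_times_le2 gT r ->
  exists a b : gT, [/\ (r < #[a])%N, commute a b, b * b = 1, <[a]> :&: <[b]> = 1 &
    <[a]> * <[b]> = [set: gT]].
Proof.
case=> i [j [A [B [ri [j12 [/cyclicP [a Aa] [/cyclicP [b Bb] [Ai [Bj /dprodP [_ AB cAB tAB]]]]]]]]]].
rewrite {}Aa {}Bb in Ai Bj AB cAB tAB; exists a, b; split=> //.
- by rewrite orderE Ai.
- apply/cent1P; rewrite -cent_cycle.
  by apply: subsetP (cycle_id a); rewrite centsC.
- rewrite -[b * b]/(b ^+ 2); apply/eqP; rewrite -order_dvdn orderE Bj.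
  by case: j12 => ->.
Qed.

Theorem theorem1 (gT : finGroupType) (n r : nat) :
  (1 <= n)%N -> nil_class_le gT n -> (4 ^ n.+1 <= r)%N -> (20 <= r)%N ->
  let cond_i := exists S : {set gT}, generating_set S /\
      two_ends_sep_le2 (cayley S) 1 r in
  let cond_ii := (exists S : {set gT}, generating_set S /\
      has_local_sep_le2 (cayley S) r) /\ (r < #|[set: gT]|)%N in
  let cond_iii := exists (i j : nat) (A B : {group gT}),
      (r < i)%N /\ (j = 1 \/ j = 2)%N /\ cyclic A /\ cyclic B /\
      #|A| = i /\ #|B| = j /\ A \x B = [set: gT] in
  (cond_i <-> cond_ii) /\ (cond_ii <-> cond_iii).
Proof.
move=> n1 nil nr r20 cond_i cond_ii cond_iii; have r2 : (1 < r)%N by lia.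
have i_iii : cond_i -> cond_iii.
  case=> S [genS ends]; have [_ [SV _]] := genS.
  have [H [cls [surj clsM clsE]]] := cover_group_ex SV r2.
  apply: (cover_cut_case genS nil n1 nr r20 _ surj clsM clsE).
    exact: (two_ends_big SV r2 clsM clsE ends).
  exact: (two_ends_cut SV r2 surj clsM clsE ends).
have ii_iii : cond_ii -> cond_iii.
  case=> -[S [genS sep] rG]; have [_ [SV _]] := genS.
  have [H [cls [surj clsM clsE]]] := cover_group_ex SV r2.
  apply: (cover_cut_case genS nil n1 nr r20 rG surj clsM clsE).
  exact: (local_sep_cut SV r2 surj clsM clsE sep).
have iii_i : cond_iii -> cond_i /\ cond_ii.
  case/cyclic_times_le2_gens => a [b [ra ab bb tab gab]].
  have SV := @abset_inv _ a b bb.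
  have [H [cls [surj clsM clsE]]] := cover_group_ex SV r2.
  have genS := abset_generating r20 ra bb gab.
  split; first by exists (abset a b); split=> //; exact: (ab_two_ends r20 ra ab bb tab clsM clsE).
  split; first by exists (abset a b); split=> //; exact: (ab_local_sep r20 ra ab bb tab clsM clsE).
  by apply: leq_trans ra _; apply: subset_leq_card; exact: subsetT.
split; split; [by case/i_iii/iii_i|by case/ii_iii/iii_i|exact: ii_iii|by case/iii_i].
Qed.
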